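(* Let $\mathcal{F}$ be a finite, vertex-critical family of graphs with $\min_{F\in\mathcal{F}}\chi(F)=r+1\geq 3$, and set $t=\max_{F\in\mathcal{F}}|V(F)|$. Then for every sufficiently small $\theta>0$ there is $n_0$ such that for every $n\geq n_0$ and every $G\in{\rm SPEX}(n,\mathcal{F})$ the following hold: (i) there is a partition $V(G)=V_1\cup\cdots\cup V_r$ such that $\big||V_i|-\frac{n}{r}\big|<\theta n$ for every $1\leq i\leq r$, and for every $1\leq i\leq r$ and every $v\in V_i$ we have $d_{V_i}(v)<t$ and $d_G(v)\geq n-|V_i|$; (ii) if $\mathbf{x}=(x_v)_{v\in V(G)}$ is a Perron vector of $G$ (a nonnegative eigenvector of the adjacency matrix for $\rho(G)$) whose largest entry equals $1$, then $x_v>1-\theta$ for every $v\in V(G)$.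
   Context: All graphs are finite, simple and undirected; $\rho(G)$ is the largest eigenvalue of the adjacency matrix of $G$, and $\chi(F)$ is the chromatic number of $F$. For a family $\mathcal{F}$ of graphs, a graph is $\mathcal{F}$-free if it contains no member of $\mathcal{F}$ as a subgraph, and ${\rm SPEX}(n,\mathcal{F})$ is the set of $\mathcal{F}$-free graphs of order $n$ with maximum spectral radius among all $\mathcal{F}$-free graphs of order $n$. A graph $F$ is vertex-critical if $\chi(F-u)=\chi(F)-1$ for some vertex $u\in V(F)$. A family $\mathcal{F}$ with $\min_{F\in\mathcal{F}}\chi(F)=r+1$ is vertex-critical if some $F_0\in\mathcal{F}$ is vertex-critical with $\chi(F_0)=r+1$. For $S\subseteq V(G)$ and $v\in V(G)$, $d_S(v)$ is the number of neighbors of $v$ in $S$, and $d_G(v)$ is the degree of $v$. *)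

(* Defs.v *)
From HB Require Import structures.
From mathcomp Require Import all_boot all_order all_algebra.
From mathcomp Require Import classical_sets reals.

Set Implicit Arguments.
Unset Strict Implicit.
Unset Printing Implicit Defensive.

Import Order.TTheory GRing.Theory Num.Theory.

Local Open Scope ring_scope.

Record sgraph := SGraph {
  vertex :> finType;
  edge : rel vertex;
  edge_sym : symmetric edge;
  edge_irr : irreflexive edge }.

Arguments edge {s} _ _.

Definition nbh_in (G : sgraph) (S : {set G}) (v : G) : {set G} :=
  [set u in S | edge v u].

Definition deg_in (G : sgraph) (S : {set G}) (v : G) : nat := #|nbh_in S v|.

Definition deg (G : sgraph) (v : G) : nat := deg_in [set: G] v.

(* Subgraphs need not be induced. *)
Definition contains_subgraph (F G : sgraph) : Prop :=
  exists f : F -> G,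
    injective f /\ forall x y : F, edge x y -> edge (f x) (f y).

Section DeleteVertex.
Variables (F : sgraph) (u : F).

Definition del_edge : rel {x : F | x != u} :=
  fun x y => edge (val x) (val y).

Lemma del_edge_sym : symmetric del_edge.
Proof. by move=> x y; exact: edge_sym. Qed.

Lemma del_edge_irr : irreflexive del_edge.
Proof. by move=> x; exact: edge_irr. Qed.

Definition del_vertex : sgraph := SGraph del_edge_sym del_edge_irr.

End DeleteVertex.

Definition colorable (F : sgraph) (k : nat) : bool :=
  [exists c : {ffun F -> 'I_k},
    [forall x, forall y, edge x y ==> (c x != c y)]].

Lemma colorable_ex (F : sgraph) : exists k, colorable F k.
Proof.
exists #|F|; apply/existsP; exists [ffun x => enum_rank x].
apply/forallP => x; apply/forallP => y; apply/implyP => exy.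
rewrite !ffunE (inj_eq enum_rank_inj).
by apply: contraTneq exy => ->; rewrite edge_irr.
Qed.

Definition chromatic_number (F : sgraph) : nat := ex_minn (colorable_ex F).

Definition vertex_critical (F : sgraph) : Prop :=
  exists u : F,
    chromatic_number (del_vertex u) = (chromatic_number F - 1)%N.

(* A finite family of graphs is a function from a finite index type. *)

Definition is_min_chromatic (I : finType) (Fam : I -> sgraph) (k : nat) :
    Prop :=
  (exists i, chromatic_number (Fam i) = k) /\
  (forall i, (k <= chromatic_number (Fam i))%N).

Definition vertex_critical_family (I : finType) (Fam : I -> sgraph) : Prop :=
  exists k, is_min_chromatic Fam k /\
    exists i, vertex_critical (Fam i) /\ chromatic_number (Fam i) = k.

Definition family_free (I : finType) (Fam : I -> sgraph) (G : sgraph) : Prop :=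
  forall i, ~ contains_subgraph (Fam i) G.

(* Rows and columns are numbered by the enumeration of the vertex type. *)
Definition adjmx (R : realType) (G : sgraph) : 'M[R]_#|G| :=
  \matrix_(i, j) (edge (enum_val i) (enum_val j))%:R.

(* The set of eigenvalues is finite, and nonempty if G has a vertex (adjmx is
   real symmetric), so the supremum is then the largest eigenvalue. *)
Definition spectral_radius (R : realType) (G : sgraph) : R :=
  sup [set mu : R | eigenvalue (adjmx R G) mu]%classic.

Definition SPEX (R : realType) (n : nat) (I : finType) (Fam : I -> sgraph)
    (G : sgraph) : Prop :=
  [/\ #|G| = n, family_free Fam G &
      forall H : sgraph, #|H| = n -> family_free Fam H ->
        spectral_radius R H <= spectral_radius R G].

Definition entry (R : realType) (G : sgraph) (x : 'cV[R]_#|G|) (v : G) : R :=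
  x (enum_rank v) 0.

Definition perron_vector (R : realType) (G : sgraph) (x : 'cV[R]_#|G|) : Prop :=
  [/\ x != 0, (forall v : G, 0 <= entry x v) &
      adjmx R G *m x = spectral_radius R G *: x].

Definition max_entry_is (R : realType) (G : sgraph) (x : 'cV[R]_#|G|) (a : R) :
    Prop :=
  (exists v : G, entry x v = a) /\ (forall v : G, entry x v <= a).

(* The family of sets V is a partition of the vertices into r nonempty,
   pairwise disjoint parts; injectivity excludes V i = V j for i != j. *)
Definition is_vertex_partition (G : sgraph) (r : nat) (V : 'I_r -> {set G}) :
    Prop :=
  injective V /\
  finset.partition [set V i | i : 'I_r]%SET [set: G]%SET.

(* Main.v *)
(** Let [t] be the largest order in the family and let a fan be a vertex joined to
    a complete [r]-partite graph with classes of size [t]: a family-free graph has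
    no fan, because the vertex-critical member embeds in one.

    Choose [S] maximising [lambda(S) - c |S|], where [lambda(S)] is the spectral
    radius of the subgraph on [S].  Deleting a vertex [v] of [S] lowers [lambda] by
    about [lambda x_v^2], so no Perron entry is small, and Cauchy-Schwarz turns this
    into a minimum degree of about [c |S|].  With [c > 1 - 1/r], the minimum degree
    version of the Erdos-Stone theorem gives [lambda <= (1 - 1/r + o(1)) n] for all
    fan-free graphs.  With [c] slightly below [1 - 1/r], the Turan lower bound on the
    spectral radius then forces [S] to be almost everything, and sorting the
    vertices of [S] by their adjacencies to one large complete [r]-partite graph
    yields disjoint sets [U_1, ..., U_r] of size about [n/r] that are almost completely
    joined.

    If [v] is given the neighbourhood [\bigcup_(j != i) U_j] instead of its own, the
    graph stays family-free, so [rho x_v] is at least the weight of that set, for all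
    [v] and [i].  A vertex of entry 1 has few neighbours in some [U_i], hence
    all the entries are close to 1 and all the degrees to [(1 - 1/r) n].  Every vertex
    can then be put in a class where it has few neighbours.  As there is no fan it has
    fewer than [t] neighbours there, and comparing its neighbourhood with the
    complement of its class, once more by extremality, bounds its degree below. *)

Require Import Defs.
From HB Require Import structures.
From mathcomp Require Import all_boot all_order all_algebra.
From mathcomp Require Import classical_sets reals topology normedtype derive.
From mathcomp Require Import fintype finset lra ring zify.

Set Implicit Arguments.
Unset Strict Implicit.
Unset Printing Implicit Defensive.

Import Order.TTheory GRing.Theory Num.Theory numFieldNormedType.Exports.

Local Open Scope ring_scope.

(** * The spectral radius as a maximal Rayleigh quotient *)

Definition nbsum (R : realType) (G : sgraph) (x : G -> R) (v : G) : R :=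
  \sum_(w | edge v w) x w.

Definition qform (R : realType) (G : sgraph) (x : G -> R) : R :=
  \sum_v x v * nbsum x v.

Definition sqnorm (R : realType) (T : finType) (x : T -> R) : R :=
  \sum_v x v ^+ 2.

Definition bump_at (R : realType) (T : eqType) (x : T -> R) (v : T) (a : R) (w : T) : R :=
  x w + a *+ (w == v).

Section Rayleigh.
Variables (R : realType) (G : sgraph).
Implicit Types x y : G -> R.

Lemma nbsumE x v : nbsum x v = \sum_w x w *+ edge v w.
Proof. by rewrite /nbsum big_mkcond; apply: eq_bigr => w _; case: edge. Qed.

Lemma nbsum_bump_at x v a w : nbsum (bump_at x v a) w = nbsum x w + a *+ edge w v.
Proof.
rewrite !nbsumE (eq_bigr (fun u => x u *+ edge w u + a *+ (u == v) *+ edge w u)); last first.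
  by move=> u _; rewrite mulrnDl.
rewrite big_split /=; congr (_ + _).
rewrite (bigD1 v) //= eqxx mulr1n big1 ?addr0 // => u /negbTE ->.
by rewrite mulr0n mul0rn.
Qed.

(** There is no term in [a ^+ 2] because [v] is not adjacent to itself. *)
Lemma qform_bump_at x v a : qform (bump_at x v a) = qform x + 2 * a * nbsum x v.
Proof.
rewrite /qform.
rewrite (eq_bigr (fun u => x u * nbsum x u + (a * (x u *+ edge v u) +
   (a * nbsum x u) *+ (u == v)))); last first.
  move=> u _; rewrite nbsum_bump_at /bump_at edge_sym.
  case: eqP => [->|_]; first rewrite edge_irr /= !mulr1n !mulr0n. ring.
  by case: edge; rewrite /= !(mulr1n, mulr0n) ?mulr0 !addr0 //; ring.
rewrite big_split /= big_split /= -mulr_sumr -nbsumE.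
rewrite [X in _ + (_ + X)](bigD1 v) //= eqxx mulr1n [X in _ + (_ + (_ + X))]big1; first ring.
by move=> u /negbTE ->.
Qed.

Lemma sqnorm_bump_at x v a :
  sqnorm (bump_at x v a) = sqnorm x + 2 * a * x v + a ^+ 2.
Proof.
rewrite /sqnorm (bigD1 v) //= [in RHS](bigD1 v) //= /bump_at eqxx mulr1n.
rewrite (eq_bigr (fun u => x u ^+ 2)); first ring.
by move=> u /negbTE ->; rewrite addr0.
Qed.

Lemma sqnorm_ge0 (T : finType) (x : T -> R) : 0 <= sqnorm x.
Proof. by apply: sumr_ge0 => v _; rewrite sqr_ge0. Qed.

Lemma nbsum_ge0 x v : (forall w, 0 <= x w) -> 0 <= nbsum x v.
Proof. by move=> x0; apply: sumr_ge0. Qed.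

Lemma qform_norm x : qform x <= qform (fun v => `|x v|).
Proof.
apply: ler_sum => v _; rewrite /nbsum !mulr_sumr; apply: ler_sum => w _.
by rewrite -normrM ler_norm.
Qed.

Lemma qformZ c x : qform (fun v => c * x v) = c ^+ 2 * qform x.
Proof.
rewrite /qform mulr_sumr; apply: eq_bigr => v _.
by rewrite /nbsum -mulr_sumr; ring.
Qed.

Lemma sqnormZ (T : finType) c (x : T -> R) :
  sqnorm (fun v => c * x v) = c ^+ 2 * sqnorm x.
Proof. by rewrite /sqnorm mulr_sumr; apply: eq_bigr => v _; rewrite exprMn. Qed.

Lemma sqnorm_eq0 (T : finType) (x : T -> R) v : sqnorm x = 0 -> x v = 0.
Proof.
move=> x0; apply/eqP; rewrite -sqrf_eq0; apply/eqP.
by apply: (psumr_eq0P _ x0) => // i _; rewrite sqr_ge0.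
Qed.

Lemma continuous_sum (T : topologicalType) (J : finType) (f : J -> T -> R) :
  (forall j, continuous (f j)) -> continuous (fun t => \sum_j f j t).
Proof.
move=> fc; elim: (index_enum J) => [|j l IH].
  rewrite (_ : (fun t => _) = fun=> 0); first by move=> t; exact: cst_continuous.
  by apply/boolp.funext => t; rewrite big_nil.
rewrite (_ : (fun t => _) = fun t => f j t + \sum_(k <- l) f k t).
  by move=> t; apply: continuousD; [exact: fc|exact: IH].
by apply/boolp.funext => t; rewrite big_cons.
Qed.

Lemma qform_max : (0 < #|G|)%N ->
  exists x, sqnorm x = 1 /\ forall y, sqnorm y = 1 -> qform y <= qform x.
Proof.
move=> G0.
(* Functions on [G] are read off row vectors, for which compactness of boxes and the extreme value
   theorem are available. *)
pose F (u : 'rV[R]_#|G|) (v : G) : R := u 0 (enum_rank v).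
pose K : set 'rV[R]_#|G| := [set u | sqnorm (F u) = 1]%classic.
have Fc v : continuous (fun u => F u v) by exact: coord_continuous.
have Fs y : exists u, F u = y.
  exists (\row_i y (enum_val i)); apply/boolp.funext => v.
  by rewrite /F mxE enum_rankK.
have qc : continuous (fun u => qform (F u)).
  apply: continuous_sum => v u.
  apply: (@continuousM R _ (fun u => F u v) (fun u => nbsum (F u) v)); first exact: Fc.
  rewrite /nbsum.
  have -> : (fun u => \sum_(w | edge v w) F u w) = (fun u => \sum_w F u w * (edge v w)%:R).
    by apply/boolp.funext => t; rewrite -/(nbsum _ _) nbsumE; apply: eq_bigr => w _; rewrite mulr_natr.
  apply: continuous_sum => w {}u; apply: (@continuousM R _ (fun u => F u w)); first exact: Fc.
  exact: cst_continuous.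
have sc : continuous (fun u => sqnorm (F u)).
  apply: continuous_sum => v u.
  by apply: (@continuousM R _ (fun u => F u v) (fun u => F u v)); exact: Fc.
have Kcl : closed K.
  rewrite (_ : K = (fun u => sqnorm (F u)) @^-1` [set 1])%classic //.
  by apply: preimage_closed; [move=> u _; exact: sc | exact: closed_eq].
have Kc : compact K.
  apply: (subclosed_compact Kcl) (@rV_compact _ _ (fun=> `[(- 1 : R), 1]%classic) _) _.
    by move=> _; apply: segment_compact.
  move=> u Ku i /=; rewrite in_itv /= -ler_norml -(@ler_pXn2r _ 2) ?nnegrE //.
  rewrite expr1n real_normK ?num_real // -Ku /sqnorm (bigD1 (enum_val i)) //=.
  by rewrite {1}/F enum_valK lerDl sumr_ge0 // => v _; rewrite sqr_ge0.
have K0 : (K !=set0)%classic.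
  case/card_gt0P: (G0) => v0 _.
  have [u Fu] := Fs (fun v => (v == v0)%:R); exists u.
  rewrite /K /= Fu /sqnorm (bigD1 v0) //= eqxx expr1n big1 ?addr0 // => w /negbTE ->.
  by rewrite expr0n.
have [u uK um] := EVT_max_rV K0 Kc (@continuous_subspaceT _ _ _ _ qc).
exists (F u); split; first by rewrite in_setE in uK.
by move=> y y1; have [w wy] := Fs y; rewrite -wy; apply: um; rewrite in_setE /K /= wy.
Qed.

(** Taking absolute values of a maximiser on the unit sphere does not lower the form, which gives a
    nonnegative maximiser. Perturbing one entry of it then yields the eigenvalue equation. *)
Lemma rayleigh_perron : (0 < #|G|)%N -> exists lam x,
  [/\ forall v, 0 <= x v, sqnorm x = 1, forall v, nbsum x v = lam * x v &
      forall y, qform y <= lam * sqnorm y].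
Proof.
move=> G0; have [x0 [x01 x0m]] := qform_max G0.
pose x v : R := `|x0 v|; exists (qform x), x.
have x1 : sqnorm x = 1.
  by rewrite -x01; apply: eq_bigr => v _; rewrite real_normK ?num_real.
have xm y : sqnorm y = 1 -> qform y <= qform x.
  by move=> /x0m /le_trans; apply; exact: qform_norm.
have xp v : 0 <= x v by exact: normr_ge0.
have ray y : qform y <= qform x * sqnorm y.
  have [y0|yn0] := eqVneq (sqnorm y) 0.
    rewrite y0 mulr0 /qform big1 // => v _.
    by rewrite (sqnorm_eq0 v y0) mul0r.
  have yp : 0 < sqnorm y by rewrite lt_def yn0 sqnorm_ge0.
  have sp : 0 < Num.sqrt (sqnorm y) by rewrite sqrtr_gt0.
  have := xm (fun v => (Num.sqrt (sqnorm y))^-1 * y v).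
  rewrite sqnormZ qformZ exprVn (sqr_sqrtr (ltW yp)) mulVf // => /(_ erefl).
  by rewrite mulrC ler_pdivrMr.
split=> // v; set l := qform x; set b := nbsum x v.
have l0 : 0 <= l by apply: sumr_ge0 => w _; rewrite mulr_ge0 ?nbsum_ge0.
(* With step [h = g / (l + 1)] the Rayleigh bound becomes [2 * h * g <= l * h ^+ 2], which forces
   [h = 0]. Dividing by [l + 1] instead of [l] covers [l = 0]. *)
have := ray (bump_at x v ((b - l * x v) / (l + 1))).
rewrite qform_bump_at sqnorm_bump_at x1 -/l -/b.
set g := b - l * x v; have -> : b = g + l * x v by rewrite /g; ring.
move=> H; have l1 : 0 < l + 1 by lra.
set h := g / (l + 1) in H *.
have gh : g = h * (l + 1) by rewrite /h divfK ?gt_eqF.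
have h0 : h = 0.
  apply/eqP; rewrite -sqrf_eq0 eq_le sqr_ge0 andbT.
  rewrite gh in H.
  have := mulr_ge0 l0 (sqr_ge0 h).
  nra.
by rewrite gh h0 mul0r add0r.
Qed.

Lemma adjmx_mulE (x : 'cV[R]_#|G|) v :
  (adjmx R G *m x) (enum_rank v) 0 = nbsum (entry x) v.
Proof.
rewrite mxE nbsumE (reindex_onto enum_rank enum_val) /=; last by move=> i _; rewrite enum_valK.
apply: eq_big => w; first by rewrite enum_rankK eqxx.
by move=> _; rewrite mxE !enum_rankK mulr_natl.
Qed.

Lemma adjmx_tr : (adjmx R G)^T = adjmx R G.
Proof. by apply/matrixP => i j; rewrite !mxE edge_sym. Qed.

(** Every eigenvalue is the Rayleigh quotient of its eigenvector, so [lam] bounds them all, and [x]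
    shows that it is attained. Symmetry of [adjmx] turns row eigenvectors into column ones. *)
Lemma spectral_radiusE lam x : sqnorm x = 1 ->
  (forall v, nbsum x v = lam * x v) ->
  (forall y, qform y <= lam * sqnorm y) -> spectral_radius R G = lam.
Proof.
move=> x1 xe ray.
have ub : ubound [set mu : R | eigenvalue (adjmx R G) mu]%classic lam.
  move=> mu /= /eigenvalueP[u ue u0].
  pose y := entry u^T.
  have ye v : nbsum y v = mu * y v.
    by rewrite -adjmx_mulE -adjmx_tr -trmx_mul ue /y /entry linearZ /= mxE.
  have yp : 0 < sqnorm y.
    rewrite lt_def sqnorm_ge0 andbT; apply: contraNneq u0 => y0.
    apply/eqP/rowP => i; rewrite mxE.
    by have := sqnorm_eq0 (enum_val i) y0; rewrite /y /entry enum_valK mxE.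
  have := ray y; rewrite (_ : qform y = mu * sqnorm y) ?ler_pM2r //.
  rewrite /qform /sqnorm mulr_sumr; apply: eq_bigr => v _.
  by rewrite ye; ring.
have lin : eigenvalue (adjmx R G) lam.
  apply/eigenvalueP; exists (\row_i x (enum_val i)).
    apply: trmx_inj; rewrite trmx_mul adjmx_tr; apply/colP => i.
    rewrite -[i]enum_valK adjmx_mulE !mxE enum_rankK -xe.
    by apply: eq_bigr => w _; rewrite /entry !mxE enum_rankK.
  apply/eqP => /rowP u0.
  have xv v : x v = 0 by have := u0 (enum_rank v); rewrite !mxE enum_rankK.
  move: x1; rewrite /sqnorm big1 => [/esym /eqP|v _]; last by rewrite xv expr0n.
  by rewrite oner_eq0.
apply/eqP; rewrite eq_le; apply/andP; split.
  by apply: ge_sup => //; exists lam.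
by apply: ub_le_sup => //; exists lam.
Qed.

Lemma perron_exists : (0 < #|G|)%N -> exists x,
  [/\ forall v, 0 <= x v, sqnorm x = 1 &
      forall v, nbsum x v = spectral_radius R G * x v].
Proof.
move=> /rayleigh_perron[l [x [x0 x1 xe ray]]]; exists x.
by rewrite (spectral_radiusE x1 xe ray).
Qed.

Lemma rayleigh y : qform y <= spectral_radius R G * sqnorm y.
Proof.
have [G0|] := posnP #|G|; last first.
  by move=> /rayleigh_perron[l [x [x0 x1 xe ray]]]; rewrite (spectral_radiusE x1 xe ray).
by rewrite /qform /sqnorm !big1 ?mulr0 // => v; have := fintype0 v G0.
Qed.

Lemma spectral_radius_ge0 : (0 < #|G|)%N -> 0 <= spectral_radius R G.
Proof.
move=> /perron_exists[x [x0 x1 xe]].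
rewrite -[spectral_radius _ _]mulr1 -x1 -/(sqnorm x) /sqnorm mulr_sumr.
by apply: sumr_ge0 => v _; rewrite expr2 mulrA -xe mulr_ge0 ?nbsum_ge0.
Qed.

Lemma perron_vector_nbsum (x : 'cV[R]_#|G|) v :
  perron_vector x -> nbsum (entry x) v = spectral_radius R G * entry x v.
Proof. by case=> _ _ xe; rewrite -adjmx_mulE xe mxE. Qed.

End Rayleigh.

(** * Subsets of large minimum degree *)

Lemma nbh_in_sub (G : sgraph) (S : {set G}) v : nbh_in S v \subset S.
Proof. by apply/subsetP => w; rewrite inE => /andP[]. Qed.

Section Restrict.
Variables (G : sgraph) (S : {set G}).

Definition restrict_edge : rel G := fun u v => [&& u \in S, v \in S & edge u v].

Lemma restrict_sym : symmetric restrict_edge.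
Proof. by move=> u v; rewrite /restrict_edge edge_sym andbCA. Qed.

Lemma restrict_irr : irreflexive restrict_edge.
Proof. by move=> u; rewrite /restrict_edge edge_irr !andbF. Qed.

(* All vertices are kept, those outside [S] becoming isolated, so that all the
   subsets of [G] share one vertex type. *)
Definition restrict : sgraph := SGraph restrict_sym restrict_irr.

End Restrict.

Section Deletion.
Variables (R : realType) (G : sgraph).
Implicit Types (S : {set G}) (x : G -> R).

Lemma sqr_sum_le (T : finType) (A : {pred T}) (f : T -> R) :
  (\sum_(i in A) f i) ^+ 2 <= #|A|%:R * \sum_(i in A) f i ^+ 2.
Proof.
rewrite expr2 big_distrlr /=.
apply: (@le_trans _ _ (\sum_(i in A) \sum_(j in A) (f i ^+ 2 / 2 + f j ^+ 2 / 2))).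
  apply: ler_sum => i _; apply: ler_sum => j _.
  have := sqr_ge0 (f i - f j); lra.
set Q := \sum_(i in A) f i ^+ 2.
rewrite (eq_bigr (fun i => #|A|%:R / 2 * f i ^+ 2 + Q / 2)) => [|i _].
  by rewrite big_split /= -mulr_sumr sumr_const -mulr_natl -/Q; lra.
by rewrite big_split /= sumr_const -mulr_suml -mulr_natl -/Q; lra.
Qed.

Lemma qformE (H : sgraph) (x : H -> R) :
  qform x = \sum_v \sum_w (x v * x w) *+ edge v w.
Proof.
apply: eq_bigr => v _; rewrite nbsumE mulr_sumr; apply: eq_bigr => w _.
by rewrite mulrnAr.
Qed.

Lemma nbsum_restrict S x v :
  @nbsum R (restrict S) x v = if v \in S then \sum_(w in nbh_in S v) x w else 0.
Proof.
case: ifP => vS; last first.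
  by rewrite /nbsum big1 // => w; rewrite /= /restrict_edge vS.
by apply: eq_bigl => w; rewrite inE /= /restrict_edge vS.
Qed.

Local Notation lam S := (spectral_radius R (restrict S)).

(** For a unit Perron vector, Cauchy-Schwarz in the eigenvalue equation gives
    [(lam S * x v) ^+ 2 <= #|S|]. Summing over [S] gives the square of the claim. *)
Lemma spectral_radius_restrict_le S : (0 < #|G|)%N -> lam S <= #|S|%:R.
Proof.
move=> G0; have [x [x0 x1 xe]] := @perron_exists R (restrict S) G0.
have l0 := @spectral_radius_ge0 R (restrict S) G0.
rewrite -(@ler_pXn2r _ 2) ?nnegrE //.
rewrite -[X in X <= _]mulr1 -[X in _ * X <= _]x1 /sqnorm mulr_sumr.
rewrite (bigID [in S]) /= [X in _ + X]big1 ?addr0 => [|v vS]; last first.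
  by rewrite -exprMn -xe nbsum_restrict (negbTE vS) expr0n.
apply: (@le_trans _ _ (\sum_(v in S) #|S|%:R)); last first.
  by rewrite sumr_const -[leLHS]mulr_natl expr2.
apply: ler_sum => v vS; rewrite -exprMn -xe nbsum_restrict vS.
apply: le_trans (sqr_sum_le _ _) _; rewrite -[X in _ <= X]mulr1.
apply: ler_pM => //.
- by apply: sumr_ge0 => w _; rewrite sqr_ge0.
- by rewrite ler_nat subset_leq_card ?nbh_in_sub.
- rewrite -x1 /sqnorm [leRHS](bigID [in nbh_in S v]) /= lerDl.
  by apply: sumr_ge0 => w _; rewrite sqr_ge0.
Qed.

(** Setting the entry at [v] to zero gives a test vector for [S :\ v] with form
    [lam S * (1 - 2 * x v ^+ 2)] and squared norm [1 - x v ^+ 2]. *)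
Lemma spectral_radius_restrict_del S x v c :
  v \in S -> sqnorm x = 1 ->
  (forall w, @nbsum R (restrict S) x w = lam S * x w) ->
  lam (S :\ v) + c <= lam S -> c <= x v ^+ 2 * (lam S + c).
Proof.
move=> vS x1 xe dl.
pose y := bump_at x v (- x v).
have := @rayleigh R (restrict (S :\ v)) y.
have -> : @qform R (restrict (S :\ v)) y = @qform R (restrict S) y.
  rewrite !qformE; apply: eq_bigr => u _; apply: eq_bigr => w _.
  rewrite /= /restrict_edge !inE.
  have yv : y v = 0 by rewrite /y /bump_at eqxx mulr1n subrr.
  have [->|_] := eqVneq u v; first by rewrite yv !mul0r !mul0rn.
  by have [->|_] := eqVneq w v; first by rewrite yv !mulr0 !mul0rn.
rewrite (@qform_bump_at R (restrict S)) xe sqnorm_bump_at x1.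
have -> : @qform R (restrict S) x = lam S.
  rewrite -[RHS]mulr1 -x1 /qform /sqnorm mulr_sumr; apply: eq_bigr => w _.
  by rewrite xe; ring.
have := sqnorm_ge0 y; rewrite sqnorm_bump_at x1; move: dl; clear xe.
by move: (lam S) (lam (S :\ v)) => l l'; nra.
Qed.

(* The subset is chosen to maximise [lam S - c * #|S|]: deleting any of its
   vertices lowers [lam] by at least [c], so all the Perron entries are large,
   and by Cauchy-Schwarz so are all the degrees. *)
Lemma extremal_subset (S0 : {set G}) c : (0 < #|G|)%N -> 0 < c ->
  c * #|S0|%:R < lam S0 ->
  exists S : {set G}, [/\ S \subset S0,
    lam S0 - c * #|S0|%:R <= lam S - c * #|S|%:R &
    forall v, v \in S -> c * #|S|%:R <= (deg_in S v)%:R + 1 \/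
      2 * c ^+ 2 * #|S|%:R <= (deg_in S v)%:R].
Proof.
move=> G0 c0 lS0.
have [S SS0 Smax] := @Order.TotalTheory.arg_maxP _ _ _ S0
  [pred S : {set G} | S \subset S0] (fun S => lam S - c * #|S|%:R) (subxx S0).
rewrite /= in SS0; exists S; split => //; first by apply: Smax; rewrite /= subxx.
move=> v vS; have [x [x0 x1 xe]] := @perron_exists R (restrict S) G0.
have q w : w \in S -> c <= x w ^+ 2 * (lam S + c).
  move=> wS; apply: spectral_radius_restrict_del => //.
  have /Smax : S :\ w \subset S0 by apply: subset_trans SS0; exact: subsetDl.
  rewrite [#|S|](cardsD1 w) wS natrD /=; clear lS0 xe.
  by move: (lam S) (lam (S :\ w)) => l l'; lra.
have l0 : c * #|S|%:R < lam S.
  have /= := Smax _ (subxx S0); move: lS0; clear q xe.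
  by move: (lam S) (lam S0) => l l'; lra.
clear lS0 Smax.
have lp : 0 < lam S by apply: le_lt_trans l0; rewrite mulr_ge0 // ltW.
move: (lam S) q l0 lp xe => l q l0 lp xe; set m : R := #|S|%:R in l0 *.
set d : R := (deg_in S v)%:R.
have d0 : 0 <= d by rewrite ler0n.
have A : l ^+ 2 * x v ^+ 2 <= d * \sum_(w in nbh_in S v) x w ^+ 2.
  by rewrite -exprMn -xe nbsum_restrict vS; exact: sqr_sum_le.
(* By [q] each of the [m - d] vertices of [S] not adjacent to [v] has squared entry at least
   [c / (l + c)]. This limits the weight left for the neighbours. *)
have B : (m - d) * c <= (1 - \sum_(w in nbh_in S v) x w ^+ 2) * (l + c).
  have -> : m - d = #|S :\: nbh_in S v|%:R.
    by rewrite cardsD (setIidPr (nbh_in_sub _ _)) natrB // subset_leq_card ?nbh_in_sub.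
  rewrite -[X in (X - _) * _]x1 /sqnorm (bigID [in nbh_in S v]) /= addrAC subrr add0r.
  rewrite mulr_natl -sumr_const mulr_suml.
  rewrite [leRHS](bigID [in S]) /= -[leLHS]addr0; apply: lerD; last first.
    by apply: sumr_ge0 => w _; rewrite mulr_ge0 ?sqr_ge0 //; lra.
  rewrite [leRHS](eq_bigl [in S :\: nbh_in S v]) => [|w]; last by rewrite in_setD.
  by apply: ler_sum => w; rewrite in_setD => /andP[_ /q].
have C : c * l ^+ 2 <= d * (l + c - c * m + c * d).
  have := q v vS; set Q := \sum_(w in _) _ in A B *; set p := x v ^+ 2 in A *.
  move=> C1.
  have : l ^+ 2 * c <= l ^+ 2 * (p * (l + c)) by rewrite ler_pM2l // exprn_gt0.
  have : l ^+ 2 * p * (l + c) <= d * Q * (l + c) by rewrite ler_pM2r //; lra.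
  have : d * ((m - d) * c) <= d * ((1 - Q) * (l + c)) by rewrite ler_wpM2l.
  lra.
have [|dlt] := lerP (2 * c ^+ 2 * m) d; first by right.
left; rewrite leNgt; apply/negP => dm.
have m0 : 0 <= m by rewrite ler0n.
(* [D] allows [l] to be replaced by its lower bound [c * m] in [C]; this is where
   [d < 2 * c ^+ 2 * m] enters. The outcome [(c * m) ^+ 2 <= d ^+ 2 + d] contradicts
   [d + 1 < c * m]. *)
have D : 0 <= (l - c * m) * (c * (l + c * m) - d).
  apply: mulr_ge0; first lra.
  have : c * (c * m) <= c * l by rewrite ler_pM2l // ltW.
  lra.
have E : 0 < c * ((c * m) ^+ 2 - d ^+ 2 - d) by apply: mulr_gt0 => //; nra.
lra.
Qed.

End Deletion.

(** * Complete multipartite subgraphs *)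

Section FiniteSets.
Variable T : finType.
Implicit Types A B : {set T}.

Lemma subset_of_card A k : (k <= #|A|)%N -> exists2 B : {set T}, B \subset A & #|B| = k.
Proof.
move=> kA; exists [set x in take k (enum A)].
  by apply/subsetP => x; rewrite inE -[x \in A]mem_enum; exact: mem_take.
have /card_uniqP : uniq (take k (enum A)) by rewrite take_uniq ?enum_uniq.
rewrite size_takel -?cardE // => E; rewrite -[RHS]E.
by apply: eq_card => x; rewrite inE.
Qed.

Lemma card_bigcup_le (J : finType) (D : {pred J}) (B : J -> {set T}) k :
  (forall j, j \in D -> #|B j| <= k)%N -> (#|\bigcup_(j in D) B j| <= #|D| * k)%N.
Proof.
move=> Bk; rewrite -sum_nat_const.
elim/big_rec2: _ => [|j n C jD IH]; first by rewrite cards0.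
by apply: leq_trans (leq_card_setU _ _) _; rewrite leq_add // Bk.
Qed.

Lemma pigeonhole (T' : finType) (h : T -> T') B (P : {set T'}) k :
  (0 < k)%N -> (forall v, v \in B -> h v \in P) -> (0 < #|B|)%N -> (#|P| * k <= #|B|)%N ->
  exists p, (k <= #|[set v in B | h v == p]|)%N.
Proof.
move=> k0 hB B0 Pk; apply/existsP; apply: contraLR Pk.
rewrite negb_exists -ltnNge => /forallP H.
have P0 : (0 < #|P|)%N.
  by case/card_gt0P: B0 => v /hB vP; apply/card_gt0P; exists (h v).
have -> : #|B| = (\sum_(p in P) #|[set v in B | h v == p]|)%N.
  rewrite -sum1_card (partition_big h [in P]) //=; apply: eq_bigr => p _.
  by rewrite -sum1_card; apply: eq_bigl => v; rewrite inE.
have : (\sum_(p in P) #|[set v in B | h v == p]| <= #|P| * k.-1)%N.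
  rewrite -sum_nat_const; apply: leq_sum => p _.
  by have := H p; rewrite -ltnNge; case: (k) k0.
move=> /leq_ltn_trans; apply.
by rewrite ltn_pmul2l // prednK.
Qed.

End FiniteSets.

Section Multipartite.
Variable G : sgraph.
Implicit Types (S A B W : {set G}) (u v w : G).

(** Distinct classes are disjoint because [edge] is irreflexive. Edges inside a class are
    allowed. *)
Definition multipartite (J : eqType) (f : J -> {set G}) : Prop :=
  forall i j u w, i != j -> u \in f i -> w \in f j -> edge u w.

Definition has_fan (r s : nat) : Prop :=
  exists v (f : 'I_r -> {set G}),
    [/\ forall i, (s <= #|f i|)%N, multipartite f &
        forall i w, w \in f i -> edge v w].

(** The vertex [u] goes to the hub, and any other [x] to the element of the class of its colour
    whose position is the rank of [x] in [F]. Classes of size [#|F|] make this injective. *)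
Lemma fan_contains (F : sgraph) (u : F) (r : nat) :
  colorable (del_vertex u) r -> has_fan r #|F| -> contains_subgraph F G.
Proof.
case/existsP => c /forallP cP [v [f [fs fm vf]]].
have cP' (x y : del_vertex u) : edge x y -> c x != c y.
  by have /forallP/(_ y)/implyP := cP x.
pose phi (x : F) : G := if insub x is Some x' then
  nth v (enum (f (c x'))) (enum_rank x) else v.
have phiin (x : F) (xu : x != u) : phi x \in f (c (Sub x xu)).
  rewrite /phi insubT -mem_enum mem_nth // -cardE.
  by apply: leq_trans (fs _); rewrite ltn_ord.
have phiu : phi u = v by rewrite /phi insubF ?eqxx.
exists phi; split.
  move=> x y; have [->|xu] := eqVneq x u.
    have [->//|yu] := eqVneq y u.
    by rewrite phiu => e; have := vf _ _ (phiin y yu); rewrite -e edge_irr.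
  have [->|yu] := eqVneq y u.
    by rewrite phiu => e; have := vf _ _ (phiin x xu); rewrite e edge_irr.
  have [e|ne] := eqVneq (c (Sub x xu : del_vertex u)) (c (Sub y yu : del_vertex u)).
    rewrite /phi !insubT e => /eqP.
    have sz z : (enum_rank (z : F) < size (enum (f (c (Sub y yu : del_vertex u)))))%N.
      by rewrite -cardE; apply: leq_trans (fs _); rewrite ltn_ord.
    rewrite nth_uniq ?enum_uniq ?sz // => /eqP /val_inj.
    exact: enum_rank_inj.
  move=> exy; have := fm _ _ _ _ ne (phiin x xu) (phiin y yu).
  by rewrite exy edge_irr.
move=> x y; have [->|xu] := eqVneq x u.
  have [->|yu] := eqVneq y u; first by rewrite edge_irr.
  by rewrite phiu => _; apply: vf (phiin y yu).
have [->|yu] := eqVneq y u.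
  by rewrite phiu edge_sym => _; rewrite edge_sym; apply: vf (phiin x xu).
move=> exy; apply: (fm _ _ _ _ _ (phiin x xu) (phiin y yu)).
exact: (cP' (Sub x xu) (Sub y yu)).
Qed.

Lemma common_nbh_card A W k :
  (forall u, u \in A -> #|W :\: nbh_in W u| <= k)%N ->
  (#|W| <= #|[set w in W | [forall u in A, edge u w]]| + #|A| * k)%N.
Proof.
move=> Ak; set C := [set w in W | _]; rewrite -(cardsID C W) leq_add //.
  by rewrite subset_leq_card // subsetIr.
apply: leq_trans (card_bigcup_le Ak); apply: subset_leq_card; apply/subsetP => w.
rewrite !inE => /andP[+ wW]; rewrite wW /= negb_forall => /existsP[u].
rewrite negb_imply => /andP[uA nuw]; apply/bigcupP; exists u => //.
by rewrite !inE wW nuw.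
Qed.

(** The classes are chosen one at a time, each inside the common neighbourhood of the at most
    [r * s] vertices chosen before. The class [i0] comes first, so [W i0] may be small and nothing
    is asked about non-neighbours in it. *)
Lemma greedy_multipartite (r s k : nat) (W : 'I_r -> {set G}) (i0 : 'I_r) :
  (s <= #|W i0|)%N ->
  (forall j, j != i0 -> s + r * s * k <= #|W j|)%N ->
  (forall i j u, j != i0 -> j != i -> u \in W i -> #|W j :\: nbh_in (W j) u| <= k)%N ->
  exists f : 'I_r -> {set G},
    [/\ forall i, #|f i| = s, forall i, f i \subset W i & multipartite f].
Proof.
move=> W0 Wj Wk.
suff H (l : seq 'I_r) : exists f : 'I_r -> {set G},
    [/\ forall i, i \in i0 :: l -> #|f i| = s, forall i, i \in i0 :: l -> f i \subset W i &
     forall i j u w, i \in i0 :: l -> j \in i0 :: l -> i != j -> u \in f i -> w \in f j -> edge u w].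
  have [f [f1 f2 f3]] := H (enum 'I_r).
  have E i : i \in i0 :: enum 'I_r by rewrite inE mem_enum orbT.
  by exists f; split=> [i|i|i j u w]; [exact: f1|exact: f2|apply: f3].
elim: l => [|j l [f [f1 f2 f3]]].
  have [B BW Bs] := subset_of_card W0.
  exists (fun=> B); split=> [i|i|i j u w]; rewrite ?inE // => /eqP->//.
  by rewrite eq_sym => /eqP->; rewrite eqxx.
have [jl|jl] := boolP (j \in i0 :: l).
  have E i : (i \in i0 :: j :: l) = (i \in i0 :: l).
    rewrite !inE orbCA; case: eqP => // ->.
    by rewrite -in_cons jl.
  by exists f; split=> [i|i|i i' u w]; rewrite !E; [exact: f1|exact: f2|apply: f3].
have ji0 : j != i0 by move: jl; rewrite inE negb_or => /andP[].
pose D := [set i in i0 :: l]; pose A := \bigcup_(i in D) f i.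
have As : (#|A| <= r * s)%N.
  apply: leq_trans (_ : (#|D| * s <= _)%N).
    by apply: card_bigcup_le => i; rewrite inE => /f1 ->.
  by rewrite leq_mul2r -[X in (_ <= X)%N]card_ord max_card orbT.
have [|B BC Bs] := @subset_of_card _ [set w in W j | [forall u in A, edge u w]] s.
  have := @common_nbh_card A (W j) k.
  have := Wj j ji0.
  have : (#|A| * k <= r * s * k)%N by rewrite leq_mul2r As orbT.
  move=> H1 H2 H3; have : (#|W j| <= #|[set w in W j | [forall u in A, edge u w]]| + #|A| * k)%N.
    apply: H3 => u /bigcupP[i]; rewrite inE => il uf.
    apply: (Wk i) => //; last exact: (subsetP (f2 i il)).
    by apply: contraNneq jl => ->.
  lia.
have Bedge i u w : i \in i0 :: l -> u \in f i -> w \in B -> edge u w.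
  move=> il uf /(subsetP BC); rewrite inE => /andP[_ /forallP/(_ u)/implyP]; apply.
  by apply/bigcupP; exists i; rewrite ?inE.
have E i : i \in i0 :: j :: l -> i != j -> i \in i0 :: l.
  by rewrite !inE orbCA => /orP[->|->].
exists (fun i => if i == j then B else f i); split=> [i il|i il|i i' u w il i'l].
- by case: eqVneq => // ij; apply: f1; exact: E.
- case: eqVneq => [->|ij]; last by apply: f2; exact: E.
  by apply: subset_trans BC _; apply/subsetP => w; rewrite inE; case/andP.
- case: (eqVneq i j) => [ij|ij]; case: (eqVneq i' j) => [i'j|i'j]; first by rewrite ij i'j eqxx.
  + by move=> _ uB wf; rewrite edge_sym; apply: (Bedge i') => //; exact: E.
  + by move=> _ uf wB; apply: (Bedge i) => //; exact: E.
  + by apply: f3; exact: E.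
Qed.

Lemma sum_deg_in A B :
  (\sum_(u in A) deg_in B u = \sum_(v in B) deg_in A v)%N.
Proof.
have E (C : {set G}) v : deg_in C v = (\sum_(w in C) edge v w)%N.
  rewrite /deg_in -sum1_card [RHS]big_mkcond /= [LHS]big_mkcond /=.
  by apply: eq_bigr => w _; rewrite inE; case: (w \in C) => //=; case: edge.
rewrite (eq_bigr (fun u => \sum_(w in B) edge u w)%N) => [|u _]; last exact: E.
rewrite exchange_big /=; apply: eq_bigr => w _; rewrite E.
by apply: eq_bigr => u _; rewrite edge_sym.
Qed.

End Multipartite.

Lemma exists_nat_ge (R : realType) (x : R) : exists n : nat, x <= n%:R.
Proof. by exists (Num.bound `|x|); apply: le_trans (ler_norm x) (ltW (archi_boundP (normr_ge0 x))). Qed.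

Lemma exists_nat_scale (R : realType) (c x : R) : 0 < c ->
  exists n0 : nat, forall n : nat, (n0 <= n)%N -> x <= c * n%:R.
Proof.
move=> c0; have [n0 n0P] := exists_nat_ge (x / c); exists n0 => n n0n.
rewrite mulrC -ler_pdivrMr //; apply: le_trans n0P _; by rewrite ler_nat.
Qed.

(** All vertices of [C] have the same neighbourhood [p] in the classes, so [k] vertices from each
    [f i :&: p] are joined to all of [C]. The new class, of index [ord_max], is taken from [C]. *)
Lemma multipartite_extend (G : sgraph) (q k : nat) (f : 'I_q.+1 -> {set G}) (C : {set G}) p :
  (0 < k)%N -> (k <= #|C|)%N ->
  (forall v, v \in C -> nbh_in (\bigcup_i f i) v = p) ->
  (forall v i, v \in C -> k <= deg_in (f i) v)%N -> multipartite f ->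
  exists g : 'I_q.+2 -> {set G}, [/\ forall i, #|g i| = k,
    forall i, g i \subset C :|: \bigcup_i f i & multipartite g].
Proof.
move=> k0 kC Cp Cf fm.
have [v0 v0C] : exists v, v \in C by apply/card_gt0P; apply: leq_trans kC.
have [B BC Bk] := subset_of_card kC.
have sel i : {D : {set G} | D \subset f i :&: p & #|D| == k}.
  apply: sig2W; suff /subset_of_card[D DS /eqP Dk] : (k <= #|f i :&: p|)%N by exists D.
  apply: leq_trans (Cf v0 i v0C) _.
  apply: subset_leq_card; apply/subsetP => w; rewrite !inE => /andP[wf ew].
  rewrite wf -(Cp v0 v0C) inE ew andbT; apply/bigcupP; by exists i.
pose g (i : 'I_q.+2) := if unlift ord_max i is Some j then s2val (sel j) else B.
have Be v w j : v \in B -> w \in s2val (sel j) -> edge v w.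
  move=> /(subsetP BC) vC; case: (sel j) => D /= /subsetP DS _ /DS.
  by rewrite inE -(Cp v vC) !inE => /and3P[].
exists g; split=> [i|i|i j u w]; rewrite /g.
- by case: unliftP => // j _; case: (sel j) => D /= _ /eqP.
- case: unliftP => [j _|_]; last by apply: subset_trans BC (subsetUl _ _).
  case: (sel j) => D /= DS _; apply: subset_trans DS _.
  apply/subsetP => w; rewrite !inE => /andP[wf _]; apply/orP; right.
  by apply/bigcupP; exists j.
- case: unliftP => [i' ->|->]; case: unliftP => [j' ->|->]; rewrite ?eqxx //.
  + rewrite (inj_eq lift_inj); case: (sel i') => D /= DS _; case: (sel j') => D' /= DS' _.
    move=> ij /(subsetP DS) /setIP[uf _] /(subsetP DS') /setIP[wf _]; exact: fm ij uf wf.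
  + by move=> _ uD wB; rewrite edge_sym; apply: Be uD.
  + by move=> _; apply: Be.
Qed.

(* With more than a [1 - 1/q] proportion of neighbours everywhere, a large complete [q]-partite
   graph sends so many edges to [S] that linearly many vertices of [S] have [T]
   neighbours in every class, and a positive proportion of them have the same
   neighbourhood in it. *)
Lemma erdos_stone_min_degree (R : realType) (q T : nat) (c : R) :
  0 < c -> c <= 1 -> (0 < T)%N ->
  exists m0 : nat, forall (G : sgraph) (S : {set G}), (m0 <= #|S|)%N ->
    (forall v, v \in S -> (q%:R - 1 + c) * #|S|%:R <= q%:R * (deg_in S v)%:R) ->
    exists f : 'I_q.+1 -> {set G},
      [/\ forall i, #|f i| = T, forall i, f i \subset S & multipartite f].
Proof.
move=> c0 c1; elim: q T => [|q IH] T T0.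
  exists T => G S mS _; have [B BS BT] := subset_of_card mS.
  by exists (fun=> B); split=> // i j; rewrite !ord1 eqxx.
have [T' T'P] := exists_nat_ge (2 * T%:R / c).
have T'c : 2 * T%:R <= c * T'%:R by rewrite [leRHS]mulrC -ler_pdivrMr.
have T'0 : (0 < T')%N.
  rewrite -(ltr0n R); have : 0 < T%:R :> R by rewrite ltr0n.
  by move=> ?; rewrite -(pmulr_rgt0 _ c0); lra.
have [m1 m1P] := IH T' T'0.
(* The power of two bounds the number of possible neighbourhoods in the [q.+1] classes, so among [N]
   vertices some [T] share one. *)
pose N := (2 ^ (q.+1 * T') * T)%N.
have c20 : 0 < c / 2 by lra.
have [m2 m2P] := exists_nat_scale N%:R c20.
exists (maxn m1 m2) => G S; rewrite geq_max => /andP[m1S m2S] Sdeg.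
have [f [fT fS fm]] : exists f : 'I_q.+1 -> {set G},
    [/\ forall i, #|f i| = T', forall i, f i \subset S & multipartite f].
  apply: m1P => // v vS; have := Sdeg v vS.
  set m : R := #|S|%:R; set d : R := (deg_in S v)%:R.
  have m0 : 0 <= m by rewrite ler0n.
  have dm : d <= m by rewrite ler_nat subset_leq_card ?nbh_in_sub.
  rewrite -natr1; lra.
pose B := [set v in S | [forall i, T <= deg_in (f i) v]%N].
(* The edges between [S] and the classes are counted from both sides. A vertex of [S] outside [B]
   accounts for at most [q * T' + T] of them, one in [B] for at most [T'] more, and
   [T <= c * T' / 2]. *)
have Bm : c / 2 * #|S|%:R <= #|B|%:R :> R.
  have lo : q.+1%:R * (T'%:R * (q%:R + c) * #|S|%:R) <= q.+1%:R * (\sum_i \sum_(u in f i) deg_in S u)%:R :> R.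
    rewrite natr_sum mulr_sumr -[q.+1 in leLHS]card_ord mulr_natl -sumr_const.
    apply: ler_sum => i _; rewrite natr_sum mulr_sumr -(fT i) -!mulrA mulr_natl -sumr_const.
    apply: ler_sum => u uf; have := Sdeg u (subsetP (fS i) u uf).
    by rewrite -natr1 addrK.
  have hi : (\sum_i \sum_(u in f i) deg_in S u <= #|S| * (q * T' + T) + #|B| * T')%N.
    rewrite (eq_bigr (fun i => \sum_(v in S) deg_in (f i) v)%N) => [|i _]; last exact: sum_deg_in.
    rewrite exchange_big /=.
    have BS : B \subset S by apply/subsetP => v; rewrite inE => /andP[].
    rewrite -!sum_nat_const [X in (_ <= _ + X)%N](_ : _ = \sum_(v in S) (if v \in B then T' else 0))%N.
      rewrite -big_split /=; apply: leq_sum => v vS.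
      have dT' i : (deg_in (f i) v <= T')%N by rewrite -(fT i) subset_leq_card ?nbh_in_sub.
      case: ifP => [_|]; last first.
        rewrite inE vS /= => /negbT; rewrite negb_forall => /existsP[i].
        rewrite -ltnNge => di; rewrite (bigD1 i) //= addn0 addnC leq_add ?(ltnW di) //.
        apply: leq_trans (_ : (\sum_(j < q.+1 | j != i) T' <= _)%N); first exact: leq_sum.
        by rewrite sum_nat_const cardC1 card_ord.
      apply: leq_trans (_ : (\sum_(j < q.+1) T' <= _)%N); first exact: leq_sum.
      by rewrite sum_nat_const card_ord mulSn; lia.
    rewrite -big_mkcondr /=; apply: eq_bigl => v.
    by case vB: (v \in B); rewrite ?andbF // (subsetP BS).
  have : T'%:R * (q%:R + c) * #|S|%:R <= #|S|%:R * (q%:R * T'%:R + T%:R) + #|B|%:R * T'%:R :> R.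
    apply: (@le_trans _ _ (\sum_i \sum_(u in f i) deg_in S u)%:R).
      by move: lo; rewrite ler_pM2l ?ltr0n.
    by rewrite -!natrM -natrD -natrM -natrD ler_nat.
  have T'R : 0 < T'%:R :> R by rewrite ltr0n.
  have Sm : 2 * T%:R * #|S|%:R <= c * T'%:R * #|S|%:R :> R by rewrite ler_wpM2r.
  move=> H; rewrite -(ler_pM2r T'R); lra.
have NB : (N <= #|B|)%N by rewrite -(ler_nat R); apply: le_trans Bm; exact: m2P.
pose K := \bigcup_i f i.
have Kc : (#|powerset K| <= 2 ^ (q.+1 * T'))%N.
  rewrite card_powerset leq_exp2l //.
  have := @card_bigcup_le _ _ (fun _ => true) f T' (fun i _ => eq_leq (fT i)).
  by rewrite (eq_card (_ : _ =i 'I_q.+1)) ?card_ord.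
have [||||p pT] := @pigeonhole _ _ (nbh_in K) B (powerset K) T => //.
- by move=> v _; rewrite inE nbh_in_sub.
- by apply: leq_trans NB; rewrite muln_gt0 T0 expn_gt0.
- by apply: leq_trans NB; rewrite leq_mul2r Kc orbT.
have [v|v i|g [g1 g2 g3]] := @multipartite_extend _ _ _ f _ p T0 pT _ _ fm.
- by rewrite inE => /andP[_ /eqP].
- by rewrite !inE => /andP[/andP[_ /forallP]].
exists g; split=> // i; apply: subset_trans (g2 i) _; rewrite subUset; apply/andP; split.
  by apply/subsetP => v; rewrite !inE => /andP[/andP[]].
by apply/bigcupsP.
Qed.

(** * The approximate partition *)

Lemma greedy_fan (G : sgraph) (r s k : nat) (v : G) (W : 'I_r -> {set G}) (i0 : 'I_r) :
  (forall i w, w \in W i -> edge v w) ->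
  (s <= #|W i0|)%N ->
  (forall j, j != i0 -> s + r * s * k <= #|W j|)%N ->
  (forall i j u, j != i0 -> j != i -> u \in W i -> #|W j :\: nbh_in (W j) u| <= k)%N ->
  has_fan G r s.
Proof.
move=> vW W0 Wj Wk; have [f [fs fW fm]] := greedy_multipartite W0 Wj Wk.
exists v, f; split=> // [i|i w /(subsetP (fW i))]; [by rewrite fs | exact: vW].
Qed.

Lemma deg_in_setD (G : sgraph) (A : {set G}) v :
  (deg_in A v + #|A :\: nbh_in A v| = #|A|)%N.
Proof. by rewrite -[RHS](cardsID (nbh_in A v)) (setIidPr (nbh_in_sub A v)). Qed.

Lemma inv_nat_bounds (R : realType) (r : nat) : (2 <= r)%N ->
  [/\ 2 <= r%:R :> R, 0 < r%:R^-1 :> R, r%:R^-1 <= 1 / 2 :> R & r%:R * r%:R^-1 = 1 :> R].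
Proof.
move=> r2; have rR : 2 <= r%:R :> R by rewrite ler_nat.
have r0 : 0 < r%:R :> R by lra.
split=> //; first by rewrite invr_gt0.
  by rewrite mul1r lef_pV2 ?posrE.
by rewrite divff // gt_eqF.
Qed.

Section Structure.
Variables (R : realType) (r s : nat).
Hypotheses (r2 : (2 <= r)%N) (s0 : (0 < s)%N).

Local Notation lam S := (spectral_radius R (restrict S)).

Lemma multipartite_fan (G : sgraph) (f : 'I_r.+1 -> {set G}) :
  (forall i, #|f i| = s) -> multipartite f -> has_fan G r s.
Proof.
move=> fs fm; have /card_gt0P[v vf] : (0 < #|f ord_max|)%N by rewrite fs.
exists v, (fun i => f (lift ord_max i)); split=> [i|i j u w ij|i w].
- by rewrite fs.
- by apply: fm; rewrite (inj_eq lift_inj).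
- by apply: fm vf; rewrite neq_lift.
Qed.

(** Otherwise the extremal subset for the penalty [1 - r%:R^-1 + c / 2] still has at least
    [c / 2 * #|S|] vertices, and its minimum degree forces [r.+1] complete classes, hence a fan. *)
Lemma fan_free_spectral_radius_le (c : R) : 0 < c -> c <= r%:R^-1 ->
  exists m0 : nat, forall (G : sgraph) (S : {set G}), ~ has_fan G r s -> (m0 <= #|S|)%N ->
    lam S <= (1 - r%:R^-1 + c) * #|S|%:R.
Proof.
move=> c0 cr; have [rR ri0 ri2 rri] := inv_nat_bounds R r2.
have [m1 m1P] := @erdos_stone_min_degree R r s (r%:R * c / 4) ltac:(nra) ltac:(nra) s0.
have [m2 m2P] := @exists_nat_scale R (c / 2) (m1%:R) ltac:(lra).
have [m3 m3P] := @exists_nat_scale R (c / 2) (4 / c) ltac:(lra).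
exists (maxn 1 (maxn m2 m3)) => G S0 nofan; rewrite !geq_max => /and3P[S1 S2 S3].
rewrite leNgt; apply/negP => big.
set c1 := 1 - r%:R^-1 + c / 2.
have G0 : (0 < #|G|)%N by apply: leq_trans S1 _; exact: max_card.
have c10 : 0 < c1 by rewrite /c1; lra.
have n0 : 0 < #|S0|%:R :> R by rewrite ltr0n.
have cl : c1 * #|S0|%:R < lam S0.
  by apply: le_lt_trans big; rewrite ler_pM2r // lerD2l ler_pdivrMr // ler_peMr ?(ltW c0) ?ler1n.
have [S [_ Sl Sd]] := extremal_subset G0 c10 cl.
have m0 : 0 <= #|S|%:R :> R by rewrite ler0n.
have ml : c / 2 * #|S0|%:R <= #|S|%:R.
  have := spectral_radius_restrict_le R S G0.
  have : 0 <= c1 * #|S|%:R by rewrite mulr_ge0 // ltW.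
  have -> : c / 2 = (1 - r%:R^-1 + c) - c1 by rewrite /c1; clear big Sl cl; lra.
  rewrite mulrBl; move: big Sl; clear cl.
  by move: (lam S) (lam S0) (c1 * _) (c1 * _) => x y z t; lra.
clear big cl Sl.
have m4 : 1 <= c / 4 * #|S|%:R.
  have : 4 / c <= #|S|%:R by apply: le_trans (m3P _ S3) ml.
  by rewrite ler_pdivrMr //; lra.
apply: nofan; have [||f [f1 _ f3]] := m1P G S; last exact: multipartite_fan f1 f3.
  by rewrite -(ler_nat R); apply: le_trans (m2P _ S2) ml.
move=> v /Sd vd; set d : R := (deg_in S v)%:R in vd *; set m : R := #|S|%:R in vd m0 m4 *.
(* The second alternative is the stronger one, because [2 * c1 >= 1]. *)
have dm : c1 * m <= d + 1.
  case: vd => // vd; apply: le_trans (_ : 2 * c1 ^+ 2 * m <= _); last lra.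
  rewrite ler_wpM2r // expr2 mulrA -[leLHS]mul1r ler_pM2r //; rewrite /c1; lra.
have : r%:R * (c1 * m) <= r%:R * (d + 1) by rewrite ler_wpM2l //; lra.
have -> : r%:R * (c1 * m) = (r%:R - 1 + r%:R * c / 2) * m.
  by rewrite /c1 mulrA; congr (_ * m); rewrite mulrDr mulrBr rri; field.
have : r%:R * 1 <= r%:R * (c / 4 * m) by rewrite ler_wpM2l //; lra.
lra.
Qed.

(** The penalty [c = 1 - r%:R^-1 - e] lies just below the Turán density. The whole vertex set then
    scores at least [e * n - 1], and a subset [S] at most [(c' + e) * #|S|]. As [c'] is small
    against [e * dlt], the maximiser misses at most [dlt * n] vertices. *)
Lemma dense_subset (eps dlt : R) : 0 < eps -> eps <= 1 -> 0 < dlt ->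
  exists n0 : nat, forall G : sgraph, (n0 <= #|G|)%N -> ~ has_fan G r s ->
    (1 - r%:R^-1) * #|G|%:R - 1 <= lam [set: G] ->
    exists S : {set G}, (1 - dlt) * #|G|%:R <= #|S|%:R /\
      forall v, v \in S -> (1 - r%:R^-1 - eps) * #|S|%:R <= (deg_in S v)%:R.
Proof.
move=> e0 e1 d0; have [rR ri0 ri2 rri] := inv_nat_bounds R r2.
pose e := eps / 8; have ep : 0 < e by rewrite /e; lra.
pose c' := Num.min r%:R^-1 (e * dlt / 2).
have c'0 : 0 < c' by rewrite /c' lt_min ri0 /=; have := mulr_gt0 ep d0; lra.
have c'1 : c' <= r%:R^-1 by rewrite /c' ge_min lexx.
have c'2 : c' <= e * dlt / 2 by rewrite /c' ge_min lexx orbT.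
have [m1 m1P] := fan_free_spectral_radius_le c'0 c'1.
have [n1 n1P] := exists_nat_scale (m1%:R + 1 + e^-1) ep.
have [n2 n2P] := @exists_nat_scale R (e * dlt / 2) 2 ltac:(have := mulr_gt0 ep d0; lra).
exists (maxn 1 (maxn n1 n2)) => G; rewrite !geq_max => /and3P[G0 G1 G2] nofan lamG.
set c := 1 - r%:R^-1 - e.
have c0 : 0 < c by rewrite /c /e; lra.
have ei : 0 < e^-1 by rewrite invr_gt0.
have m1p : 0 <= m1%:R :> R by rewrite ler0n.
set n : R := #|G|%:R in lamG *.
have {}n1P := n1P _ G1; have {}n2P := n2P _ G2; rewrite -/n in n1P n2P.
have cn : c * n = (1 - r%:R^-1) * n - e * n by rewrite /c; ring.
have nT : #|[set: G]|%:R = n by rewrite cardsT.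
have [|S [_ Sl Sd]] := @extremal_subset R G [set: G] c G0 c0.
  by rewrite nT; apply: lt_le_trans lamG; lra.
rewrite nT in Sl; exists S; set m : R := #|S|%:R in Sl Sd *.
have m0 : 0 <= m by rewrite ler0n.
have lm : lam S <= m by apply: spectral_radius_restrict_le.
have cm0 : 0 <= c * m by rewrite mulr_ge0 // ltW.
have lub : m1%:R <= m -> lam S <= (1 - r%:R^-1 + c') * m by rewrite ler_nat; exact: m1P.
move: (lam S) (lam [set: G]) lm Sl lub lamG => l L lm Sl lub lamG.
clear m1P.
(* The trivial bound [lam S <= #|S|] already makes [S] large enough for the sharper bound [lub]. *)
have mbig : e * n - 1 <= m by lra.
split.
  have ub : l <= (1 - r%:R^-1 + c') * m by apply: lub; lra.
  rewrite leNgt; apply/negP => small.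
  have H1 : e * n - 1 <= (c' + e) * m by rewrite /c in Sl cn; lra.
  have H2 : (c' + e) * m <= (e * dlt / 2 + e) * m by rewrite ler_wpM2r //; lra.
  have H3 : (e * dlt / 2 + e) * m <= (e * dlt / 2 + e) * ((1 - dlt) * n).
    by rewrite ler_wpM2l ?(ltW small) //; have := mulr_gt0 ep d0; lra.
  have H4 : 0 <= e * dlt * dlt * n.
    exact: mulr_ge0 (mulr_ge0 (mulr_ge0 (ltW ep) (ltW d0)) (ltW d0)) (ler0n _ _).
  lra.
move=> v /Sd vd; set d : R := (deg_in S v)%:R in vd *.
have em : 1 <= e * m.
  have eim : e^-1 <= m by lra.
  by rewrite mulrC -ler_pdivrMr // mul1r.
case: vd => vd; first by rewrite /c in vd; rewrite /e in vd em *; lra.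
apply: le_trans vd; rewrite ler_wpM2r //.
have cE : c = 1 - r%:R^-1 - e by [].
have eE : e = eps / 8 by [].
have H1 : 0 <= c * (2 * c - 1 + 2 * e) by apply: mulr_ge0; lra.
have H2 : c * e <= 1 * e by rewrite ler_pM2r //; lra.
rewrite expr2; clearbody c e; lra.
Qed.

(* The class [U i] consists of the vertices adjacent to nearly all of a fixed large
   complete [r]-partite graph, except for its [i]-th class. *)
Lemma cluster (dlt : R) : 0 < dlt ->
  exists eps : R, [/\ 0 < eps, eps <= 1 & exists m0 : nat,
    forall (G : sgraph) (S : {set G}), ~ has_fan G r s -> (m0 <= #|S|)%N ->
    (forall v, v \in S -> (1 - r%:R^-1 - eps) * #|S|%:R <= (deg_in S v)%:R) ->
    exists U : 'I_r -> {set G},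
      [/\ forall i j v, v \in U i -> v \in U j -> i = j,
          forall i, (r%:R^-1 - dlt) * #|S|%:R <= #|U i|%:R &
          forall i j v, j != i -> v \in U i ->
            #|U j :\: nbh_in (U j) v|%:R <= dlt * #|S|%:R]].
Proof.
move=> d0; have [rR ri0 ri2 rri] := inv_nat_bounds R r2.
have [h hP] := exists_nat_ge (4 * s%:R / dlt).
have sR : 0 < s%:R :> R by rewrite ltr0n.
have hd : 4 * s%:R <= dlt * h%:R by rewrite [leRHS]mulrC -ler_pdivrMr.
have h0 : (0 < h)%N.
  by rewrite -(ltr0n R) -(pmulr_rgt0 _ d0); lra.
pose C := (1 + s + r * s)%N.
have C1 : 1 <= C%:R :> R by rewrite ler1n.
have C0 : 0 < C%:R :> R by lra.
(* The class size [T] leaves room for a greedy selection after [h] missed vertices. It is [C * h]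
   with [C] independent of [h], so [eps] can make [r * T * eps] small against [h]. *)
have [T TE TR] : exists2 T, (s + r * s * h + h <= T)%N & T%:R = C%:R * h%:R :> R.
  exists (C * h)%N; last by rewrite natrM.
  by rewrite /C !mulnDl mul1n addnAC leq_add2r addnC leq_add2l leq_pmulr.
clearbody C.
have T0 : (0 < T)%N by apply: leq_trans TE; rewrite addn_gt0 h0 orbT.
have rC : 0 < 4 * r%:R * C%:R :> R by rewrite !mulr_gt0 //; lra.
pose eps := Num.min (dlt / (4 * r%:R * C%:R)) (r%:R^-1 * r%:R^-1 / 2).
have e1 : r%:R * C%:R * eps <= dlt / 4.
  have : eps <= dlt / (4 * r%:R * C%:R) by rewrite /eps ge_min lexx.
  by rewrite ler_pdivlMr //; lra.
have e2 : eps <= r%:R^-1 * r%:R^-1 / 2 by rewrite /eps ge_min lexx orbT.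
have e0 : 0 < eps.
  by rewrite /eps lt_min divr_gt0 //= mulr_gt0 ?mulr_gt0 // invr_gt0.
have e3 : r%:R * eps <= r%:R^-1 / 2.
  have : r%:R * eps <= r%:R * (r%:R^-1 * r%:R^-1 / 2) by rewrite ler_wpM2l //; lra.
  by rewrite !mulrA rri mul1r.
exists eps; split=> //.
  have : 2 * eps <= r%:R * eps by rewrite ler_pM2r.
  lra.
have [m1 m1P] := @erdos_stone_min_degree R r.-1 T (r%:R^-1 / 2) ltac:(lra) ltac:(lra) T0.
have [m2 m2P] := @exists_nat_scale R (dlt / 4) (r%:R * s%:R) ltac:(lra).
exists (maxn m1 m2) => G S nofan; rewrite geq_max => /andP[Sm1 Sm2] Sdeg.
have {}m2P := m2P _ Sm2; set m : R := #|S|%:R in m2P Sdeg *.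
have m0 : 0 <= m by rewrite ler0n.
have rpred : r.-1%:R = r%:R - 1 :> R by rewrite -[r in RHS]prednK ?(ltnW r2) // -natr1 addrK.
have [f [fT fS fm]] : exists f : 'I_r -> {set G},
    [/\ forall i, #|f i| = T, forall i, f i \subset S & multipartite f].
  have := m1P G S Sm1; rewrite prednK ?(ltnW r2) //; apply=> v vS.
  have := Sdeg v vS; rewrite rpred -/m; set d : R := (deg_in S v)%:R => H.
  have : (r%:R - 1) * ((1 - r%:R^-1 - eps) * m) <= (r%:R - 1) * d by rewrite ler_wpM2l //; lra.
  apply: le_trans; rewrite mulrA ler_wpM2r //.
  have -> : (r%:R - 1) * (1 - r%:R^-1 - eps) = r%:R - r%:R * r%:R^-1 - 1 + r%:R^-1 - (r%:R * eps) + eps by ring.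
  rewrite rri; lra.
(* A vertex with [s] neighbours in every class would be the hub of a fan. *)
have low v : exists i, (deg_in (f i) v < s)%N.
  apply/existsP; apply: contra_notT nofan; rewrite negb_exists => /forallP H.
  exists v, (fun i => nbh_in (f i) v); split=> [i|i j u w ij|i w].
  - by rewrite leqNgt H.
  - by rewrite !inE => /andP[uf _] /andP[wf _]; apply: fm ij uf wf.
  - by rewrite inE => /andP[].
pose U i := [set v in S | (deg_in (f i) v < s)%N &&
   [forall j, (j != i) ==> (#|f j :\: nbh_in (f j) v| <= h)%N]].
have Umiss i j v : j != i -> v \in U i -> (#|f j :\: nbh_in (f j) v| <= h)%N.
  by move=> ji; rewrite inE => /and3P[_ _ /forallP/(_ j)]; rewrite ji.
have Ulow i v : v \in U i -> (deg_in (f i) v < s)%N by rewrite inE => /and3P[].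
have US i : U i \subset S by apply/subsetP => v; rewrite inE => /andP[].
have Udisj i j v : v \in U i -> v \in U j -> i = j.
  move=> vi vj; apply/eqP; apply/negPn/negP => ij.
  have := Umiss _ _ _ ij vj; have := deg_in_setD (f i) v; have := Ulow _ _ vi.
  rewrite fT; move: TE; clear; lia.
pose J := S :\: \bigcup_i U i.
(* Edges to the classes are double counted. Each vertex of [S] has fewer than [s] neighbours in some
   class, and one in [J] also misses more than [h] vertices of another, so it falls short of
   [r.-1 * T + s] by at least [h]. *)
have Jcard : #|J|%:R <= (dlt / 2) * m.
  have lo : r%:R * (T%:R * ((1 - r%:R^-1 - eps) * m)) <= (\sum_i \sum_(u in f i) deg_in S u)%:R :> R.
    rewrite natr_sum -[X in X%:R * (T%:R * _)]card_ord mulr_natl -sumr_const.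
    apply: ler_sum => i _; rewrite natr_sum -(fT i) mulr_natl -sumr_const.
    by apply: ler_sum => u /(subsetP (fS i)) /Sdeg.
  have hi : (\sum_i \sum_(u in f i) deg_in S u + #|J| * h <= #|S| * (r.-1 * T + s))%N.
    rewrite (eq_bigr (fun i => \sum_(v in S) deg_in (f i) v)%N) => [|i _]; last exact: sum_deg_in.
    rewrite exchange_big /= -!sum_nat_const.
    rewrite [X in (_ + X <= _)%N](_ : _ = \sum_(v in S) (if v \in J then h else 0))%N; last first.
      rewrite -big_mkcondr /=; apply: eq_bigl => v.
      by rewrite in_setD andbA andbC; case: (v \in S); rewrite ?andbT ?andbF.
    rewrite -big_split /=; apply: leq_sum => v vS.
    have dT i : (deg_in (f i) v <= T)%N by rewrite -(fT i) subset_leq_card ?nbh_in_sub.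
    have [i di] := low v.
    have cI : (#|[pred j : 'I_r | j != i]| = r.-1)%N by rewrite -[r in RHS]card_ord cardC1.
    case: ifP => vJ; last first.
      rewrite addn0 (bigD1 i) //= addnC leq_add ?(ltnW di) //.
      apply: leq_trans (_ : (\sum_(j < r | j != i) T <= _)%N); first exact: leq_sum.
      by rewrite sum_nat_const cI.
    have [j ji jh] : exists2 j, j != i & (h < #|f j :\: nbh_in (f j) v|)%N.
      move: vJ; rewrite in_setD vS andbT => /bigcupP vU; apply/exists_inP.
      apply: contra_notT vU; rewrite negb_exists => /forallP H; exists i => //.
      rewrite inE vS di /=; apply/forallP => j; apply/implyP => ji.
      by have := H j; rewrite negb_and ji /= -leqNgt.
    rewrite (bigD1 i) //= (bigD1 j) //=.
    have : (\sum_(k < r | (k != i) && (k != j)) deg_in (f k) v <= r.-2 * T)%N.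
      apply: leq_trans (_ : (\sum_(k < r | (k != i) && (k != j)) T <= _)%N); first exact: leq_sum.
      rewrite sum_nat_const leq_mul2r; apply/orP; right.
      have := cardD1 j [pred k : 'I_r | k != i]; rewrite cI inE /= ji /=.
      rewrite (_ : #|[predD1 _ & j]| = #|[pred k : 'I_r | (k != i) && (k != j)]|); first by move=> ->; rewrite add1n.
      by apply: eq_card => k; rewrite !inE andbC.
    have := deg_in_setD (f j) v; rewrite fT.
    have -> : (r.-1 * T = r.-2 * T + T)%N by rewrite -mulSnr prednK // -ltnS prednK // ltnW.
    move: jh di; clear; move: (\sum_(k < r | _) _)%N (r.-2 * T)%N => x y; lia.
  have {}hi : (\sum_i \sum_(u in f i) deg_in S u)%:R + #|J|%:R * h%:R <= m * ((r%:R - 1) * T%:R + s%:R) :> R.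
    by rewrite -rpred -!natrM -!natrD -natrM ler_nat.
  have key : #|J|%:R * h%:R <= m * (s%:R + r%:R * T%:R * eps).
    have E : r%:R * (T%:R * ((1 - r%:R^-1 - eps) * m)) = m * ((r%:R - r%:R * r%:R^-1) * T%:R - r%:R * T%:R * eps) by ring.
    rewrite E rri in lo; lra.
  have hR : 0 < h%:R :> R by rewrite ltr0n.
  rewrite -(ler_pM2r hR); apply: le_trans key _.
  have -> : dlt / 2 * m * h%:R = m * (dlt / 2 * h%:R) by ring.
  rewrite ler_wpM2l //.
  have : r%:R * C%:R * eps * h%:R <= dlt / 4 * h%:R by rewrite ler_wpM2r // ltW.
  rewrite TR; lra.
(* If [v] had [s] neighbours in [U i], these would replace the [i]-th class, the other classes being
   cut down to the neighbours of [v], and a fan would appear. *)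
have Uin i v : v \in U i -> (deg_in (U i) v < s)%N.
  move=> vU; rewrite ltnNge; apply/negP => big; apply: nofan.
  apply: (@greedy_fan G r s h v (fun j => if j == i then nbh_in (U i) v else nbh_in (f j) v) i).
  - by move=> j w; case: eqP => _; rewrite inE => /andP[].
  - by rewrite eqxx.
  - move=> j ji; rewrite (negbTE ji); have := deg_in_setD (f j) v; rewrite fT.
    by have := Umiss _ _ _ ji vU; rewrite /deg_in; move: TE; clear; lia.
  - move=> i' j u ji jj'; rewrite (negbTE ji).
    have sub : nbh_in (f j) v :\: nbh_in (nbh_in (f j) v) u \subset f j :\: nbh_in (f j) u.
      by apply/subsetP => w; rewrite !inE; case: (w \in f j); case: (edge v w); case: (edge u w).
    move=> uW; apply: leq_trans (subset_leq_card sub) _; move: uW.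
    case: eqP => [_|/eqP i'i]; first by rewrite inE => /andP[uU _]; exact: Umiss ji uU.
    rewrite inE => /andP[uf _]; rewrite (_ : f j :\: _ = set0) ?cards0 //.
    apply/setP => w; rewrite !inE; case wf: (w \in f j); rewrite ?andbF //= andbT.
    by rewrite (fm i' j u w) // eq_sym.
have Uup i v : v \in U i -> (#|U i| + deg_in S v <= #|S| + s)%N.
  move=> vU; have := Uin i v vU; have : (deg_in S v <= deg_in (U i) v + #|S :\: U i|)%N.
    rewrite /deg_in -(cardsID (U i) (nbh_in S v)); apply: leq_add.
      by apply/subset_leq_card/subsetP => w; rewrite !inE => /andP[/andP[_ ->] ->].
    by apply/subset_leq_card/setSD/nbh_in_sub.
  by have := cardsID (U i) S; rewrite (setIidPr (US i)); clear; lia.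
have UupR i : #|U i|%:R <= (r%:R^-1 + eps) * m + s%:R.
  have [->|/set0Pn[v vU]] := eqVneq (U i) set0.
    by rewrite cards0 addr_ge0 ?ler0n // mulr_ge0 //; lra.
  have := Uup i v vU; rewrite -(ler_nat R) !natrD -/m.
  have := Sdeg v (subsetP (US i) v vU); lra.
(* The classes and [J] cover [S], and [UupR] bounds the other [r.-1] classes from above. *)
have Ulo i : r%:R^-1 * m - dlt / 2 * m - (r%:R - 1) * (eps * m + s%:R) <= #|U i|%:R.
  have cov : (#|S| <= #|J| + \sum_j #|U j|)%N.
    rewrite -(cardsID (\bigcup_j U j) S) addnC leq_add2l.
    apply: leq_trans (_ : (#|\bigcup_j U j| <= _)%N); first by rewrite subset_leq_card ?subsetIr.
    elim/big_rec2: _ => [|j k A _ IH]; first by rewrite cards0.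
    by apply: leq_trans (leq_card_setU _ _) _; rewrite leq_add2l.
  move: cov; rewrite (bigD1 i) //= -(ler_nat R) !natrD natr_sum -/m.
  have : \sum_(j < r | j != i) #|U j|%:R <= \sum_(j < r | j != i) ((r%:R^-1 + eps) * m + s%:R) :> R.
    by apply: ler_sum => j _; exact: UupR.
  rewrite sumr_const (_ : #|_| = r.-1); last by rewrite -[r in RHS]card_ord cardC1.
  rewrite -[X in _ <= X]mulr_natl rpred.
  have -> : (r%:R - 1) * ((r%:R^-1 + eps) * m + s%:R) = (r%:R * r%:R^-1) * m - r%:R^-1 * m + (r%:R - 1) * (eps * m + s%:R) by ring.
  rewrite rri; lra.
have rem : r%:R * (eps * m) <= dlt / 4 * m.
  rewrite mulrA ler_wpM2r //.
  apply: le_trans e1; rewrite mulrAC -[leLHS]mulr1 ler_wpM2l // mulr_ge0 //; lra.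
have sm : 0 <= eps * m by rewrite mulr_ge0 // ltW.
clearbody U; exists U; split=> //.
  move=> i; apply: le_trans (Ulo i); lra.
move=> i j v ji vU.
(* Nearly all of [U i] is missed by [v]. By the degree bound this uses up almost all its
   non-neighbours in [S], leaving few for [U j]. *)
have : (#|U j :\: nbh_in (U j) v| + deg_in S v + #|U i| <= #|S| + s)%N.
  have H : (#|U j :\: nbh_in (U j) v| + #|U i :\: nbh_in (U i) v| <= #|S :\: nbh_in S v|)%N.
    rewrite -cardsUI (_ : _ :&: _ = set0) ?cards0 ?addn0.
      apply/subset_leq_card/subsetP => w; rewrite !inE.
      by case/orP => /andP[+ wU]; rewrite wU (subsetP (US _) _ wU) /= ?andbT.
    apply/setP => w; rewrite !inE; apply/negP => /andP[/andP[_ wj] /andP[_ wi]].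
    by rewrite (Udisj _ _ _ wj wi) eqxx in ji.
  have := deg_in_setD (U i) v; have := Uin i v vU; have := deg_in_setD S v; move: H; clear; lia.
rewrite -(ler_nat R) !natrD -/m.
have := Sdeg v (subsetP (US i) v vU); have := Ulo i; lra.
Qed.

Lemma approximate_partition (dlt : R) : 0 < dlt -> dlt <= 1 ->
  exists n0 : nat, forall G : sgraph, (n0 <= #|G|)%N -> ~ has_fan G r s ->
    (1 - r%:R^-1) * #|G|%:R - 1 <= lam [set: G] ->
    exists U : 'I_r -> {set G},
      [/\ forall i j v, v \in U i -> v \in U j -> i = j,
          forall i, (r%:R^-1 - dlt) * #|G|%:R <= #|U i|%:R &
          forall i j v, j != i -> v \in U i ->
            #|U j :\: nbh_in (U j) v|%:R <= dlt * #|G|%:R].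
Proof.
move=> d0 d1; have [rR ri0 ri2 rri] := inv_nat_bounds R r2.
have [eps [e0 e1 [m0 m0P]]] := @cluster (dlt / 2) ltac:(lra).
have [n1 n1P] := @dense_subset eps (dlt / 2) e0 e1 ltac:(lra).
have [n2 n2P] := @exists_nat_scale R (1 - dlt / 2) m0%:R ltac:(lra).
exists (maxn n1 n2) => G; rewrite geq_max => /andP[G1 G2] nofan lamG.
have [S [Sn Sd]] := n1P G G1 nofan lamG.
have [|U [U1 U2 U3]] := m0P G S nofan _ Sd.
  by rewrite -(ler_nat R); apply: le_trans (n2P _ G2) Sn.
have Sle : #|S|%:R <= #|G|%:R :> R by rewrite ler_nat max_card.
have S0 : 0 <= #|S|%:R :> R by rewrite ler0n.
exists U; split=> // [i|i j v ji vU].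
  apply: le_trans (U2 i).
  have : r%:R^-1 * ((1 - dlt / 2) * #|G|%:R) <= r%:R^-1 * #|S|%:R by rewrite ler_pM2l.
  have : dlt * #|G|%:R * r%:R^-1 <= dlt * #|G|%:R * (1 / 2).
    by rewrite ler_wpM2l // mulr_ge0 ?ler0n // ltW.
  have : dlt * #|S|%:R <= dlt * #|G|%:R by rewrite ler_pM2l.
  lra.
apply: le_trans (U3 i j v ji vU) _.
have : dlt * #|S|%:R <= dlt * #|G|%:R by rewrite ler_pM2l.
have : 0 <= dlt * #|S|%:R by rewrite mulr_ge0 // ltW.
lra.
Qed.

End Structure.

(** * Changing one neighbourhood *)

Section Rewire.
Variables (G : sgraph) (v : G) (W : {set G}).

Definition rewire_edge : rel G := fun u w =>
  if u == v then (w \in W) && (w != v) else if w == v then u \in W else edge u w.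

Lemma rewire_sym : symmetric rewire_edge.
Proof.
move=> u w; rewrite /rewire_edge; case: (eqVneq u v) => uv; case: (eqVneq w v) => wv.
- by rewrite uv wv.
- by rewrite andbT.
- by rewrite andbT.
- exact: edge_sym.
Qed.

Lemma rewire_irr : irreflexive rewire_edge.
Proof. by move=> u; rewrite /rewire_edge edge_irr; case: eqP; rewrite ?andbF. Qed.

Definition rewire : sgraph := SGraph rewire_sym rewire_irr.

(** In a copy of [F] through [v], the neighbours of [v] form a set [A] of fewer than [t] vertices of
    [W]. One of their [t] common neighbours in [G] avoids the rest of the copy and can replace
    [v]. *)
Lemma rewire_free (F : sgraph) t : (#|F| <= t)%N -> ~ contains_subgraph F G ->
  (forall A : {set G}, A \subset W -> (#|A| < t)%N ->
    (t <= #|[set z | [forall u in A, edge u z]]|)%N) ->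
  ~ contains_subgraph F rewire.
Proof.
move=> Ft FG Wt [f [finj fedge]]; apply: FG.
have [/existsP[a /eqP fa]|] := boolP [exists a, f a == v]; last first.
  rewrite negb_exists => /forallP fv; exists f; split=> // x y /fedge.
  by rewrite /= /rewire_edge (negbTE (fv x)) (negbTE (fv y)).
pose A : {set G} := f @: [set b | edge a b].
have Acard : (#|A| < t)%N.
  apply: leq_trans Ft; apply: leq_ltn_trans (leq_imset_card _ _) _.
  by rewrite -cardsT proper_card // properT; apply/eqP => /setP/(_ a); rewrite !inE edge_irr.
have AW : A \subset W.
  apply/subsetP => _ /imsetP[b + ->]; rewrite inE => /fedge.
  by rewrite /= /rewire_edge fa eqxx => /andP[].
have /subsetPn[z zZ zf] : ~~ ([set z | [forall u in A, edge u z]] \subset f @: [set~ a]).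
  apply/negP => /subset_leq_card; rewrite leqNgt => /negP; apply.
  apply: leq_trans (Wt A AW Acard); apply: leq_trans Ft.
  apply: leq_ltn_trans (leq_imset_card _ _) _; rewrite -cardsT proper_card // properT.
  by apply/eqP => /setP/(_ a); rewrite !inE eqxx.
have zN b : b != a -> f b != z.
  by move=> ba; apply: contraNneq zf => <-; apply/imset_f; rewrite !inE.
have az b : edge a b -> edge z (f b).
  move=> ab; rewrite edge_sym; move: zZ; rewrite inE => /forallP/(_ (f b))/implyP; apply.
  by apply/imset_f; rewrite inE.
exists (fun b => if b == a then z else f b); split=> [b c|b c].
  case: (eqVneq b a) => [->|ba]; case: (eqVneq c a) => [->|ca] //.
  - by move=> e; have := zN c ca; rewrite e eqxx.
  - by move=> e; have := zN b ba; rewrite e eqxx.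
  - exact: finj.
case: (eqVneq b a) => [->|ba]; case: (eqVneq c a) => [->|ca].
- by rewrite edge_irr.
- exact: az.
- by move=> eba; rewrite edge_sym; apply: az; rewrite edge_sym.
move=> /fedge; rewrite /= /rewire_edge -fa !(inj_eq finj).
by rewrite (negbTE ba) (negbTE ca).
Qed.

End Rewire.

(* If [W] carried more weight than the neighbourhood of [v], then giving [v] the
   neighbourhood [W] and slightly raising its entry would increase the Rayleigh
   quotient. *)
Lemma spex_rewire_le (R : realType) (n : nat) (I : finType) (Fam : I -> sgraph)
    (G : sgraph) (x : G -> R) (v : G) (W : {set G}) :
  SPEX R n Fam G -> family_free Fam (rewire v W) ->
  0 < spectral_radius R G -> (forall w, 0 <= x w) ->
  (forall w, nbsum x w = spectral_radius R G * x w) ->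
  \sum_(w in W | w != v) x w <= spectral_radius R G * x v.
Proof.
move=> [Gn Gfree Gmax] Wfree rho0 x0 xe.
set rho := spectral_radius R G in rho0 xe *; set a := \sum_(w in W | _) _.
have rhoW : spectral_radius R (rewire v W) <= rho by apply: Gmax.
rewrite leNgt; apply/negP => ab.
pose x1 := bump_at x v (- x v).
have x1v : x1 v = 0 by rewrite /x1 /bump_at eqxx mulr1n subrr.
have x1w w : w != v -> x1 w = x w.
  by move=> /negbTE wv; rewrite /x1 /bump_at wv addr0.
have q1 : @qform R (rewire v W) x1 = @qform R G x1.
  rewrite !qformE; apply: eq_bigr => u _; apply: eq_bigr => w _.
  rewrite /= /rewire_edge; have [->|_] := eqVneq u v; first by rewrite x1v !mul0r !mul0rn.
  by have [->|_] := eqVneq w v; first by rewrite x1v !mulr0 !mul0rn.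
have s1 : @nbsum R (rewire v W) x1 v = a.
  rewrite /nbsum /a; apply: eq_big => w; first by rewrite /= /rewire_edge eqxx.
  by rewrite /= /rewire_edge eqxx => /andP[_ /x1w].
have qx : @qform R G x = rho * sqnorm x.
  by rewrite /qform /sqnorm mulr_sumr; apply: eq_bigr => w _; rewrite xe; ring.
(* The new entry [x v + tau] equals [a / rho], which maximises [2 * a * y - rho * y ^+ 2] over
   [y]. *)
pose tau := (a - rho * x v) / rho.
have tau0 : 0 < tau by rewrite divr_gt0 // subr_gt0.
have tauE : rho * tau = a - rho * x v by rewrite /tau mulrC divfK // gt_eqF.
pose z := bump_at x1 v (x v + tau).
have := @rayleigh R (rewire v W) z.
rewrite (@qform_bump_at R (rewire v W)) q1 s1 qform_bump_at xe qx.
have : spectral_radius R (rewire v W) * sqnorm z <= rho * sqnorm z.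
  by rewrite ler_wpM2r // sqnorm_ge0.
rewrite sqnorm_bump_at sqnorm_bump_at x1v.
move: (spectral_radius R (rewire v W) * _) => y H1 H2.
have xv0 := x0 v.
have H3 : 0 < tau * (rho * tau) by rewrite mulr_gt0 // mulr_gt0.
have H4 : 0 <= x v * (rho * tau) by rewrite mulr_ge0 // mulr_ge0 // ltW.
have aE : a = rho * tau + rho * x v by rewrite tauE; ring.
clearbody a tau; clear rhoW; move: H1 H2; rewrite aE; clearbody rho; lra.
Qed.

(** * Turán graphs and their spectral radius *)

Section Turan.
Variables (n r : nat).

Definition turan_edge : rel 'I_n := fun i j => (i %% r != j %% r)%N.

Lemma turan_sym : symmetric turan_edge.
Proof. by move=> i j; rewrite /turan_edge eq_sym. Qed.

Lemma turan_irr : irreflexive turan_edge.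
Proof. by move=> i; rewrite /turan_edge eqxx. Qed.

Definition turan : sgraph := SGraph turan_sym turan_irr.

Lemma turan_contains_colorable (F : sgraph) :
  (0 < r)%N -> contains_subgraph F turan -> colorable F r.
Proof.
move=> r0 [f [_ fe]]; apply/existsP; exists [ffun x => Ordinal (ltn_pmod (f x) r0)].
apply/forallP => x; apply/forallP => y; apply/implyP => /fe; rewrite !ffunE.
by rewrite -val_eqE.
Qed.

(** The constant vector is the test vector: a residue class modulo [r] has at most [n %/ r + 1]
    elements, which bounds every degree from below. *)
Lemma turan_spectral_radius_ge (R : realType) : (0 < n)%N -> (0 < r)%N ->
  (1 - r%:R^-1) * n%:R - 1 <= spectral_radius R turan.
Proof.
move=> n0 r0; have := @rayleigh R turan (fun=> 1).
have -> : @sqnorm R turan (fun=> 1) = n%:R.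
  by rewrite /sqnorm sumr_const expr1n card_ord.
rewrite -ler_pdivrMr ?ltr0n //; apply: le_trans.
rewrite ler_pdivlMr ?ltr0n //.
have deg_ge (i : turan) : (1 - r%:R^-1) * n%:R - 1 <= nbsum (fun=> 1 : R) i.
  rewrite /nbsum sumr_const.
  pose C := [set j : 'I_n | j %% r == i %% r]%N.
  have Cc : (#|C| <= (n %/ r).+1)%N.
    pose h (j : 'I_n) : 'I_(n %/ r).+1 := inord (j %/ r)%N.
    have hE (j : 'I_n) : h j = (j %/ r)%N :> nat.
      by rewrite inordK // ltnS leq_div2r // ltnW.
    rewrite -[X in (_ <= X)%N]card_ord -(card_in_imset (f := h) (D := C)) ?max_card //.
    move=> j k; rewrite !inE => /eqP jc /eqP kc /(congr1 val) /=; rewrite !hE => jk.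
    by apply: val_inj; rewrite /= (divn_eq j r) (divn_eq k r) jc kc jk.
  have -> : #|[pred j : turan | edge i j]| = #|~: C|.
    by apply: eq_card => j; rewrite !inE eq_sym.
  have : #|C|%:R + #|~: C|%:R = n%:R :> R by rewrite -natrD cardsC card_ord.
  have : (n %/ r)%:R <= r%:R^-1 * n%:R :> R.
    rewrite mulrC ler_pdivlMr ?ltr0n // -natrM ler_nat; exact: leq_trunc_div.
  have : #|C|%:R <= (n %/ r)%:R + 1 :> R by rewrite natr1 ler_nat.
  lra.
apply: (@le_trans _ _ (\sum_(i < n) ((1 - r%:R^-1) * n%:R - 1))).
  by rewrite sumr_const card_ord [leLHS]mulr_natr.
by apply: ler_sum => i _; rewrite mul1r.
Qed.

End Turan.

(** * From Perron entries to degrees *)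

Section Entries.
Variables (R : realType) (G : sgraph) (x : G -> R).

Lemma sum_entries_le (A : {pred G}) : (forall v, x v <= 1) -> \sum_(w in A) x w <= #|A|%:R.
Proof.
move=> x1; apply: le_trans (_ : \sum_(w in A) 1 <= _); last by rewrite sumr_const.
by apply: ler_sum => w _.
Qed.

(* Compare [v] with a vertex of entry 1, whose neighbourhood exceeds some
   [\bigcup_(j | j != i) U j] by at most [M] vertices. *)
Lemma entries_close (r : nat) (U : 'I_r -> {set G}) (rho M : R) :
  (forall v, 0 <= x v) -> (forall v, x v <= 1) -> (exists u, x u = 1) ->
  (forall v, nbsum x v = rho * x v) ->
  (forall v i, \sum_(w in \bigcup_(j | j != i) U j | w != v) x w <= rho * x v) ->
  (forall v, exists i, (deg_in (U i) v)%:R + #|~: \bigcup_j U j|%:R <= M) ->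
  forall v, rho <= rho * x v + M + 1.
Proof.
move=> x0 x1 [u xu] xe lo up v; have [i iM] := up u.
set B := \bigcup_(j | j != i) U j.
have H1 : rho <= \sum_(w in B) x w + M.
  have -> : rho = nbsum x u by rewrite xe xu mulr1.
  apply: (@le_trans _ _ (\sum_(w in B) x w +
    (\sum_(w in nbh_in (U i) u) x w + \sum_(w in ~: \bigcup_j U j) x w))); last first.
    rewrite lerD2l; apply: le_trans iM.
    by rewrite lerD //; exact: sum_entries_le.
  rewrite /nbsum !(big_mkcond [in _]) (big_mkcond (edge u)) /= -!big_split /=.
  apply: ler_sum => w _; have xw := x0 w; case: ifP => uw; last first.
    by rewrite !addr_ge0 //; case: ifP.
  have [wB|wB] := boolP (w \in B).
    by rewrite lerDl addr_ge0 //; case: ifP.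
  have [wU|wU] := boolP (w \in U i).
    by rewrite inE wU uw /= add0r lerDl; case: ifP.
  rewrite !inE (negbTE wU) /= !add0r; case: bigcupP => // -[j _ wj].
  case: (eqVneq j i) => [ji|ji]; first by rewrite -ji wj in wU.
  by case/bigcupP: wB; exists j.
have H2 : \sum_(w in B) x w <= rho * x v + 1.
  have := lo v i; rewrite -/B => H.
  rewrite (bigID [pred w | w != v]) /=; apply: lerD => //.
  apply: le_trans (_ : \sum_(w | w == v) x w <= _); last by rewrite big_pred1_eq.
  rewrite big_mkcond [leRHS]big_mkcond; apply: ler_sum => w _.
  by have xw := x0 w; case: (w \in B); case: (eqVneq w v) => //= _; rewrite ?xw.
lra.
Qed.

(** If the degree were smaller, [v] would have more non-neighbours outside [A] than neighbours
    inside, say [b >= d + 1]. The weights give [b * (1 - eta) < d], impossible since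
    [(d + 1) * eta <= t%:R * eta <= 1]. *)
Lemma degree_ge (A : {set G}) (v : G) (t : nat) (eta : R) :
  (forall w, x w <= 1) -> (forall w, 1 - eta < x w) -> 0 < eta -> t%:R * eta <= 1 ->
  (deg_in A v < t)%N -> \sum_(w in ~: A) x w <= nbsum x v ->
  (#|G| - #|A| <= deg v)%N.
Proof.
move=> x1 xl e0 te At le.
have AG : #|~: A| = (#|G| - #|A|)%N by rewrite -(cardsC A) addKn.
rewrite -AG leqNgt; apply/negP => dlt.
pose N := [set w | edge v w].
have dE : deg v = (deg_in A v + #|~: A :&: N|)%N.
  rewrite /deg /deg_in -(cardsID A); congr addn; apply: eq_card => w; rewrite !inE.
    by rewrite andbC.
  by rewrite andbC.
pose b := #|~: A :\: N|.
have bE : #|~: A| = (b + #|~: A :&: N|)%N by rewrite addnC cardsID.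
have ab : (deg_in A v < b)%N by rewrite bE dE ltn_add2r in dlt.
have H1 : \sum_(w in ~: A :\: N) x w <= \sum_(w in nbh_in A v) x w.
  rewrite -(lerD2r (\sum_(w in ~: A :&: N) x w)).
  apply: le_trans (le_trans _ le) _.
    by rewrite [leRHS](big_setID N) /= addrC.
  rewrite /nbsum (bigID [in A]) /= lerD //.
    by rewrite le_eqVlt; apply/orP; left; apply/eqP; apply: eq_bigl => w; rewrite !inE andbC.
  by rewrite le_eqVlt; apply/orP; left; apply/eqP; apply: eq_bigl => w; rewrite !inE andbC.
have H2 : \sum_(w in nbh_in A v) x w <= (deg_in A v)%:R by exact: sum_entries_le.
have [w0 w0b] : exists w, w \in ~: A :\: N by apply/card_gt0P; apply: leq_ltn_trans ab.
have H3 : b%:R * (1 - eta) < \sum_(w in ~: A :\: N) x w.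
  rewrite mulr_natl -sumr_const; apply: ltr_sum => //; first by apply/hasP; exists w0.
have t1 : 1 <= t%:R :> R by rewrite ler1n; apply: leq_ltn_trans At.
move: ab At; rewrite -(ler_nat R) -natr1 => ab; rewrite -(ler_nat R) -natr1 => At.
set d := (deg_in A v)%:R in ab At H2; set B := b%:R in ab H3.
have e1 : 0 <= 1 - eta by nra.
have : (d + 1) * (1 - eta) <= B * (1 - eta) by rewrite ler_wpM2r.
have : (d + 1) * eta <= t%:R * eta by rewrite ler_pM2r.
lra.
Qed.

End Entries.

(** * Entries and degrees of extremal graphs *)

Lemma colorable_chromatic_number (F : sgraph) : colorable F (chromatic_number F).
Proof. by rewrite /chromatic_number; case: ex_minnP. Qed.

Lemma chromatic_number_le (F : sgraph) k : colorable F k -> (chromatic_number F <= k)%N.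
Proof. by rewrite /chromatic_number; case: ex_minnP => m _ H /H. Qed.

Lemma spectral_radius_restrictT (R : realType) (G : sgraph) : (0 < #|G|)%N ->
  spectral_radius R G <= spectral_radius R (restrict [set: G]).
Proof.
move=> /(perron_exists R)[x [_ x1 xe]].
have := @rayleigh R (restrict [set: G]) x; rewrite x1 mulr1; apply: le_trans.
have -> : @qform R (restrict [set: G]) x = qform x.
  by rewrite !qformE; apply: eq_bigr => u _; apply: eq_bigr => w _; rewrite /= /restrict_edge !inE.
rewrite -[leLHS]mulr1 -[X in _ * X]x1 /sqnorm /qform mulr_sumr.
by apply: ler_sum => v _; rewrite xe expr2 [leLHS]mulrCA.
Qed.

(** Otherwise the greedy selection inside the neighbourhoods of [v] in the classes gives a fan with
    hub [v]. *)
Lemma low_degree_class (G : sgraph) (r t k : nat) (U : 'I_r -> {set G}) (v : G) :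
  (0 < r)%N -> ~ has_fan G r t ->
  (forall i j u, j != i -> u \in U i -> #|U j :\: nbh_in (U j) u| <= k)%N ->
  exists i, (deg_in (U i) v < t + r * t * k)%N.
Proof.
move=> r0 nofan Uk; apply/existsP; apply: contra_notT nofan.
rewrite negb_exists => /forallP H.
apply: (@greedy_fan G r t k v (fun i => nbh_in (U i) v) (Ordinal r0)).
- by move=> i w; rewrite inE => /andP[].
- by apply: leq_trans (_ : (t + r * t * k <= _)%N); rewrite ?leq_addr // leqNgt H.
- by move=> j _; rewrite leqNgt H.
- move=> i j u _ ji; rewrite inE => /andP[uU _]; apply: leq_trans (Uk i j u ji uU).
  apply/subset_leq_card/subsetP => w; rewrite !inE.
  by case: (w \in U j); case: (edge v w); case: (edge u w).
Qed.

(** The neighbours of [v] in its own class serve as the small first class of the greedy selection,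
    where [t] vertices suffice. *)
Lemma inner_degree_lt (G : sgraph) (r t k : nat) (V : 'I_r -> {set G}) (i : 'I_r) (v : G) :
  ~ has_fan G r t -> v \in V i ->
  (forall i j u, j != i -> u \in V i -> #|V j :\: nbh_in (V j) u| <= k)%N ->
  (forall j, t + r * t * k + k <= #|V j|)%N ->
  (deg_in (V i) v < t)%N.
Proof.
move=> nofan vV Vk Vt; rewrite ltnNge; apply/negP => big; apply: nofan.
apply: (@greedy_fan G r t k v (fun i => nbh_in (V i) v) i) => //.
- by move=> j w; rewrite inE => /andP[].
- move=> j ji; have := Vt j; have := Vk _ _ _ ji vV; have := deg_in_setD (V j) v.
  rewrite /deg_in; clear; move: (t + r * t * k)%N => y; lia.
- move=> i' j u _ ji; rewrite inE => /andP[uU _]; apply: leq_trans (Vk i' j u ji uU).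
  apply/subset_leq_card/subsetP => w; rewrite !inE.
  by case: (w \in V j); case: (edge v w); case: (edge u w).
Qed.

(** Fewer than [t] vertices of [W] together miss at most [t * k] vertices of [A], so [t] common
    neighbours remain in [A]. *)
Lemma rewire_family_free (I : finType) (Fam : I -> sgraph) (G : sgraph) (t k : nat)
    (A W : {set G}) (v : G) :
  family_free Fam G -> (forall i, #|Fam i| <= t)%N ->
  (forall u, u \in W -> #|A :\: nbh_in A u| <= k)%N -> (t + t * k <= #|A|)%N ->
  family_free Fam (rewire v W).
Proof.
move=> Gfree Ft Wk At i; apply: (rewire_free (Ft i)); first exact: Gfree.
move=> B BW Bt; have := @common_nbh_card G B A k (fun u uB => Wk u (subsetP BW u uB)).
have : (#|B| * k <= t * k)%N by rewrite leq_mul2r (ltnW Bt) orbT.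
have : (#|[set w in A | [forall u in B, edge u w]]| <= #|[set z | [forall u in B, edge u z]]|)%N.
  by apply/subset_leq_card/subsetP => w; rewrite !inE => /andP[].
move: At; clear; move: (t * k)%N (#|B| * k)%N => y z; lia.
Qed.

(** Converts real bounds such as [dlt * N] into the natural number [k] of missed vertices used in
    the greedy selection. *)
Lemma truncn_spec (R : realType) (x : R) : 0 <= x ->
  (Num.truncn x)%:R <= x /\ forall m : nat, m%:R <= x -> (m <= Num.truncn x)%N.
Proof.
move=> x0; have /andP[lo hi] := Num.Theory.truncn_itv x0; split=> // m mx.
by rewrite -ltnS -(ltr_nat R); apply: le_lt_trans hi.
Qed.

Lemma disjoint_cover_card (T : finType) (r : nat) (V : 'I_r -> {set T}) :
  (forall i j v, v \in V i -> v \in V j -> i = j) ->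
  (\sum_i #|V i| + #|~: \bigcup_i V i| = #|T|)%N.
Proof.
move=> Vd; rewrite -[RHS](cardsC (\bigcup_i V i)); congr addn; rewrite -[RHS]sum1_card.
rewrite (eq_bigr (fun i => \sum_(v in V i) 1)%N); last by move=> i _; rewrite sum1_card.
rewrite (exchange_big_dep [in \bigcup_i V i]) /=.
  apply: eq_bigr => v /bigcupP[i _ vi]; rewrite (big_pred1 i) // => j /=.
  by apply/idP/eqP => [vj|->//]; exact: Vd vj vi.
by move=> i v _ vi; apply/bigcupP; exists i.
Qed.

Lemma disjoint_card_bounds (R : realType) (T : finType) (r : nat) (V : 'I_r -> {set T}) (c : R) :
  (forall i j v, v \in V i -> v \in V j -> i = j) -> (forall i, c <= #|V i|%:R) ->
  #|~: \bigcup_i V i|%:R <= #|T|%:R - r%:R * c /\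
  forall i, #|V i|%:R <= #|T|%:R - (r%:R - 1) * c.
Proof.
move=> /disjoint_cover_card <- Vc; rewrite natrD natr_sum; split=> [|i].
  have : \sum_(i < r) c <= \sum_i #|V i|%:R by apply: ler_sum.
  by rewrite sumr_const card_ord -[X in X <= _ -> _]mulr_natl; lra.
have S1 : r.-1%:R * c <= \sum_(j | j != i) #|V j|%:R.
  apply: le_trans (_ : \sum_(j < r | j != i) c <= _); last exact: ler_sum.
  by rewrite sumr_const mulr_natl -[r in leLHS]card_ord cardC1.
have rE : r = r.-1.+1 by rewrite prednK // (leq_ltn_trans _ (ltn_ord i)).
rewrite (bigD1 i) //=.
have -> : r%:R = r.-1%:R + 1 :> R by rewrite natr1 -rE.
have : 0 <= #|~: \bigcup_j V j|%:R :> R by rewrite ler0n.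
lra.
Qed.

Lemma perron_max1_exists (R : realType) (G : sgraph) : (0 < #|G|)%N ->
  exists x : G -> R, [/\ forall v, 0 <= x v, forall v, x v <= 1, exists u, x u = 1 &
    forall v, nbsum x v = spectral_radius R G * x v].
Proof.
move=> /(perron_exists R)[y [y0 y1 ye]].
have /existsP[v0 v0P] : [exists v, y v != 0].
  apply: contraTT isT; rewrite negb_exists => /forallP H.
  have /eqP := y1; rewrite /sqnorm big1 ?(eq_sym 0) ?oner_eq0 // => v _.
  by have := H v; rewrite negbK => /eqP ->; rewrite expr0n.
have [u _ umax] := @Order.TotalTheory.arg_maxP _ _ _ v0 predT y isT.
have yu : 0 < y u.
  by apply: lt_le_trans (umax v0 isT); rewrite lt_def v0P y0.
exists (fun v => (y u)^-1 * y v); split=> [v|v||v].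
- by rewrite mulr_ge0 // invr_ge0 ltW.
- by rewrite mulrC ler_pdivrMr // mul1r; exact: umax.
- by exists u; rewrite mulVf // gt_eqF.
- by rewrite /nbsum -mulr_sumr -/(nbsum y v) ye mulrCA.
Qed.

(** Here [b] stands for [r], [eta] for the deficit of the entries and [dlt] for the error of the
    approximate partition. Losses of order [r * t * dlt * n] must fit into [eta * n], and losses of
    order [r * t * eta * n] into a class of size about [n / r]. *)
Lemma parameter_choice (R : realType) (b t theta : R) :
  2 <= b -> 1 <= t -> 0 < theta -> theta < 1 ->
  exists eta dlt : R, [/\ 0 < eta, eta <= theta, 0 < dlt,
    32 * ((b * t + 2) * eta) <= b^-1 & 16 * (b * t * dlt + dlt) = eta].
Proof.
move=> b2 t1 th0 th1; have btt : 2 <= b * t by nra.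
pose K := 32 * b * (b * t + 2); have K1 : 1 <= K by rewrite /K; nra.
have eK : theta / K * K = theta by rewrite divfK // gt_eqF //; lra.
have e0 : 0 < theta / K by rewrite divr_gt0 //; lra.
have bt1 : 0 < 16 * (b * t + 1) by lra.
exists (theta / K), (theta / K / (16 * (b * t + 1))); split=> //.
- by rewrite -[leRHS]eK ler_peMr // ltW.
- exact: divr_gt0.
- have b0 : 0 < b by lra.
  rewrite -(ler_pM2l b0) divff ?gt_eqF //; apply: le_trans (ltW th1).
  by rewrite -[leRHS]eK /K le_eqVlt; apply/orP; left; apply/eqP; ring.
- by field; rewrite !gt_eqF // /K; nra.
Qed.

Theorem theorem3p1 (R : realType) (r : nat) (I : finType) (Fam : I -> sgraph)
    (t : nat)
    (hcrit : vertex_critical_family Fam)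
    (hmin : is_min_chromatic Fam r.+1)
    (hr : (3 <= r.+1)%N)
    (ht : t = (\max_(i : I) #|Fam i|)%N) :
  exists theta0 : R, 0 < theta0 /\
  forall theta : R, 0 < theta -> theta < theta0 ->
  exists n0 : nat, forall n : nat, (n0 <= n)%N ->
  forall G : sgraph, SPEX R n Fam G ->
    (exists V : 'I_r -> {set G},
      [/\ is_vertex_partition V,
          (forall i : 'I_r, `| #|V i|%:R - n%:R / r%:R | < theta * n%:R) &
          (forall (i : 'I_r) (v : G), v \in V i ->
             (deg_in (V i) v < t)%N /\ (n - #|V i| <= deg v)%N)]) /\
    (forall x : 'cV[R]_#|G|, perron_vector x -> max_entry_is x 1 ->
       forall v : G, 1 - theta < entry x v).
Proof.
have r2 : (2 <= r)%N by [].
have r0 : (0 < r)%N by apply: ltnW.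
have [k [[hk1 hk2] [i0 [[u0 hu0] hi0]]]] := hcrit.
have kE : k = r.+1.
  have [[i1 h1] h2] := hmin; apply/eqP; rewrite eqn_leq -{1}h1 hk2 /=.
  by rewrite -hi0 h2.
have Ft i : (#|Fam i| <= t)%N by rewrite ht; apply: (leq_bigmax (F := fun i => #|Fam i|)).
have t0 : (0 < t)%N by apply: leq_trans (Ft i0); apply/card_gt0P; exists u0.
have nofan G : family_free Fam G -> ~ has_fan G r t.
  move=> Gfree [v [f [fs fm vf]]]; apply: (Gfree i0); apply: (@fan_contains G (Fam i0) u0 r).
    by have := colorable_chromatic_number (del_vertex u0); rewrite hu0 hi0 kE subn1.
  by exists v, f; split=> // i; exact: leq_trans (Ft i0) (fs i).
have turan_free n : family_free Fam (turan n r).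
  move=> i /(turan_contains_colorable r0) /chromatic_number_le.
  by rewrite leqNgt => /negP; apply; exact: (proj2 hmin).
have [rR ri0 ri2 rri] := inv_nat_bounds R r2.
have tR : 1 <= t%:R :> R by rewrite ler1n.
exists 1; split=> [//|theta th0 th1].
set b : R := r%:R in rR ri0 ri2 rri *; set tt : R := t%:R in tR *.
have bE : r%:R = b by []; have tE : t%:R = tt by []; clearbody b tt.
have [eta [dlt [e0 eth d0 e1 d1]]] := parameter_choice rR tR th0 th1.
have btt : 2 <= b * tt by rewrite -[leLHS]mulr1 ler_pM.
have bd : 0 < b * dlt by apply: mulr_gt0 => //; lra.
have bdt : b * dlt <= b * tt * dlt by rewrite mulrAC ler_peMr // ltW.
have td0 : 0 < tt * dlt by rewrite mulr_gt0 //; lra.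
have tdt : tt * dlt <= b * tt * dlt by rewrite -mulrA ler_peMl ?(ltW td0) //; lra.
have tte : 2 * (tt * eta) <= b * tt * eta by rewrite mulrA ler_pM2r // ler_pM2r //; lra.
have [n1 n1P] := @approximate_partition R r t r2 t0 dlt d0 ltac:(lra).
have [n2 n2P] := @exists_nat_scale R eta (32 * (tt + 1)) e0.
exists (maxn 1 (maxn n1 n2)) => n; rewrite !geq_max => /and3P[G0 G1 G2] G spex.
have [Gn Gfree Gmax] := spex.
have fanG := nofan G Gfree.
rewrite -{1}Gn in G0; rewrite -Gn in G1.
(* The Turán graph is [Fam]-free, as its subgraphs are [r]-colourable, so by extremality it bounds
   [rho] from below. *)
have rho_lo := turan_spectral_radius_ge R (leq_trans G0 (eq_leq Gn)) r0.
have {}rho_lo := le_trans rho_lo (Gmax (turan n r) (card_ord n) (turan_free n)).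
rewrite bE in rho_lo; have {}n2P := n2P n G2.
have [U [Ud Usz Um]] : exists U : 'I_r -> {set G},
      [/\ forall i j v, v \in U i -> v \in U j -> i = j,
          forall i, (b^-1 - dlt) * n%:R <= #|U i|%:R &
          forall i j v, j != i -> v \in U i ->
            #|U j :\: nbh_in (U j) v|%:R <= dlt * n%:R].
  have := n1P G G1 fanG; rewrite Gn bE; apply.
  by apply: le_trans rho_lo _; exact: spectral_radius_restrictT.
have rew x v W := @spex_rewire_le R n I Fam G x v W spex.
have [p [p0 p1 p2 pe]] := perron_max1_exists R G0.
have perron x := @perron_vector_nbsum R G x.
move: rho_lo rew pe; rewrite /perron_vector in perron *.
set rho := spectral_radius R G in perron *; clearbody rho.
clear spex Gmax n1P turan_free nofan; move=> rho_lo rew pe.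
set N : R := n%:R in rho_lo n2P Usz Um *.
have N1 : 1 <= N by rewrite ler1n -Gn.
have NE : #|G|%:R = N by rewrite Gn.
clearbody N.
have rN : b^-1 * N <= 1 / 2 * N by rewrite ler_pM2r //; lra.
have eN : 64 <= eta * N by lra.
have rN2 : 32 * ((b * tt + 2) * eta * N) <= b^-1 * N.
  by rewrite mulrA ler_pM2r //; lra.
have btN : 0 <= b * tt * eta * N.
  by apply: mulr_ge0 (le_trans ler01 N1); apply: mulr_ge0 (ltW e0); lra.
have dN0 : 0 <= dlt * N by exact: mulr_ge0 (ltW d0) (le_trans ler01 N1).
have bdN0 : 0 <= b * tt * dlt * N.
  by apply: mulr_ge0 (le_trans ler01 N1); apply: mulr_ge0 (ltW d0); lra.
have dN : 16 * (b * tt * dlt * N + dlt * N) = eta * N by rewrite -d1; ring.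
have ee : eta <= 1 by lra.
have rho0 : 0 < rho.
  have : eta * N <= 1 * N by rewrite ler_pM2r //; lra.
  lra.
have tN : 2 * (tt * eta * N) <= b * tt * eta * N by rewrite mulrA ler_pM2r //; lra.
have bdN : b * dlt * N <= b * tt * dlt * N by rewrite ler_pM2r //; lra.
have btd0 : 0 <= b * tt by lra.
have tdN : tt * dlt * N <= b * tt * dlt * N by rewrite ler_pM2r //; lra.
have te1 : tt * eta <= 1 by lra.
clear e1 d1 bdt td0 tdt tte bd btt.
have [k1lo k1hi] := truncn_spec dN0; set k1 := Num.truncn _ in k1lo k1hi.
have Um1 i j u : j != i -> u \in U i -> (#|U j :\: nbh_in (U j) u| <= k1)%N.
  by move=> ji ui; apply: k1hi; exact: Um ji ui.
have btk : b * tt * k1%:R <= b * tt * dlt * N by rewrite -[leRHS]mulrA ler_wpM2l.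
have tk : tt * k1%:R <= b * tt * dlt * N.
  apply: le_trans (_ : tt * (dlt * N) <= _); first by rewrite ler_wpM2l //; lra.
  by rewrite mulrA.
have Ucov : #|~: \bigcup_i U i|%:R <= b * dlt * N.
  have [+ _] := disjoint_card_bounds Ud Usz; rewrite NE bE.
  have -> : b * ((b^-1 - dlt) * N) = b / b * N - b * dlt * N by ring.
  rewrite rri; lra.
have low v := low_degree_class v r0 fanG Um1.
(* This is stated for any such [x]: it is applied to the Perron vector given in (ii) and to the
   auxiliary vector [p] in (i). *)
have near (x : G -> R) : (forall v, 0 <= x v) -> (forall v, x v <= 1) ->
    (exists u, x u = 1) -> (forall v, nbsum x v = rho * x v) ->
    forall v, 1 - eta < x v.
  move=> x0 x1 xu xe v.
  have := @entries_close R G x r U rho (tt + b * tt * dlt * N + b * tt * dlt * N) x0 x1 xu xe.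
  have H1 u i : \sum_(w in \bigcup_(j | j != i) U j | w != u) x w <= rho * x u.
    apply: rew => //; apply: (@rewire_family_free I Fam G t k1 (U i)) => //.
      by move=> w /bigcupP[j ji wj]; apply: Um1 wj; rewrite eq_sym.
    rewrite -(ler_nat R) natrD natrM tE; apply: le_trans (Usz i); lra.
  have H2 u : exists i, (deg_in (U i) u)%:R + #|~: \bigcup_j U j|%:R <= tt + b * tt * dlt * N + b * tt * dlt * N.
    have [i /ltnW] := low u; rewrite -(ler_nat R) natrD !natrM tE bE => H.
    by exists i; lra.
  move=> /(_ H1 H2 v) H; rewrite ltNge; apply/negP => xv.
  have : rho * x v <= rho * (1 - eta) by rewrite ler_pM2l.
  have : (N / 2 - 1) * eta <= rho * eta by rewrite ler_pM2r //; lra.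
  lra.
split; last first.
  move=> x xp [xu xm] v.
  apply: le_lt_trans (near (entry x) _ xm xu (perron x ^~ xp) v); first lra.
  by case: xp.
have px := near p p0 p1 p2 pe.
have [g gP] : exists g : G -> 'I_r, forall v, (deg_in (U (g v)) v < t + r * t * k1)%N.
  by apply: (@fin_all_exists _ (fun=> 'I_r) (fun v i => (deg_in (U i) v < t + r * t * k1)%N)).
have gR v : (deg_in (U (g v)) v)%:R <= tt + b * tt * dlt * N.
  by have /ltnW := gP v; rewrite -(ler_nat R) natrD !natrM tE bE; lra.
(* A vertex of [U j] is adjacent to nearly all of every other [U i], so its only class with few
   neighbours is [U j]. *)
have gU v j : v \in U j -> g v = j.
  move=> vj; apply/eqP; apply/negPn/negP => gj.
  have := Um _ _ _ gj vj; have := gR v; have := Usz (g v).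
  rewrite -(deg_in_setD (U (g v)) v) natrD; lra.
pose V i := [set v | g v == i].
have UV i : U i \subset V i by apply/subsetP => v /gU; rewrite inE => ->.
have Vsz i : (b^-1 - dlt) * N <= #|V i|%:R.
  by apply: le_trans (Usz i) _; rewrite ler_nat subset_leq_card.
have Vd i j v : v \in V i -> v \in V j -> i = j.
  by rewrite !inE => /eqP <- /eqP <-.
have [k2lo k2hi] := @truncn_spec R (2 * eta * N) ltac:(lra).
set k2 := Num.truncn _ in k2lo k2hi.
(* The entry of [v] bounds its degree from below, and [v] misses nearly all of [U i], which lies in
   [V i] and is disjoint from [V j]. So at most about [2 * eta * N] missed vertices remain for
   [V j]. *)
have Vm i j v : j != i -> v \in V i -> (#|V j :\: nbh_in (V j) v| <= k2)%N.
  move=> ji; rewrite inE => /eqP gv; apply: k2hi.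
  have degv : (1 - b^-1) * N - 1 - eta * N <= (deg v)%:R.
    have : nbsum p v <= (deg v)%:R.
      apply: le_trans (sum_entries_le _ p1) _; rewrite ler_nat subset_leq_card //.
      by apply/subsetP => w; rewrite !inE.
    rewrite pe; have := px v => pv.
    have : rho * (1 - eta) <= rho * p v by rewrite ler_pM2l // ltW.
    have : ((1 - b^-1) * N - 1) * (1 - eta) <= rho * (1 - eta) by rewrite ler_wpM2r //; lra.
    have : 0 <= b^-1 * (eta * N).
      by apply: mulr_ge0 (ltW ri0) _; apply: mulr_ge0 (ltW e0) (le_trans ler01 N1).
    lra.
  have H : (#|V j :\: nbh_in (V j) v| + #|U i :\: nbh_in (U i) v| + deg v <= #|G|)%N.
    have := deg_in_setD [set: G] v; rewrite cardsT -/(deg v) => <-.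
    rewrite addnC leq_add2l -cardsUI (_ : _ :&: _ = set0) ?cards0 ?addn0.
      apply/subset_leq_card/subsetP => w; rewrite in_setU !in_setD in_setT andbT => Hw.
      apply/negP; rewrite inE in_setT /= => vw.
      by case/orP: Hw => /andP[/negP Hw wj]; apply: Hw; rewrite inE wj.
    apply/setP => w; rewrite !inE; apply/negP => /andP[/andP[_ wj] /andP[_ wi]].
    by move: ji; rewrite -(gU w i wi) eq_sym wj.
  have := gR v; have := Usz i; rewrite gv -(deg_in_setD (U i) v) natrD.
  by move: H; rewrite -(ler_nat R) !natrD NE; lra.
have btk2 : b * tt * k2%:R <= b * tt * (2 * eta * N) by rewrite ler_wpM2l.
have ttk2 : tt * k2%:R <= tt * (2 * eta * N) by rewrite ler_wpM2l //; lra.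
have inner i v : v \in V i -> (deg_in (V i) v < t)%N.
  move=> vi; apply: (inner_degree_lt fanG vi Vm) => j.
  rewrite -(ler_nat R) !natrD !natrM tE bE; apply: le_trans (Vsz j); lra.
exists V; split.
- have Vne i : exists v, v \in V i.
    apply/card_gt0P; rewrite -(ltr0n R); apply: lt_le_trans (Vsz i); lra.
  have Vinj : injective V.
    move=> i j Vij; have [v vi] := Vne i; apply: (Vd _ _ v) => //; by rewrite -Vij.
  split=> //; apply/and3P; split.
  + rewrite eqEsubset subsetT /=; apply/subsetP => v _.
    by apply/bigcupP; exists (V (g v)); [exact: imset_f | rewrite inE].
  + apply/trivIsetP => _ _ /imsetP[i _ ->] /imsetP[j _ ->] ij.
    rewrite -setI_eq0; apply/eqP/setP => v; rewrite inE in_set0.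
    by apply/negP => /andP[vi vj]; rewrite (Vd _ _ _ vi vj) eqxx in ij.
  + by apply/negP => /imsetP[i _ V0]; have [v] := Vne i; rewrite -V0 inE.
- move=> i.
  have [_ /(_ i)] := disjoint_card_bounds Vd Vsz; rewrite NE bE.
  have -> : (b - 1) * ((b^-1 - dlt) * N) = b / b * N - b^-1 * N - b * dlt * N + dlt * N by ring.
  rewrite rri => up; have lo := Vsz i.
  have thN : eta * N <= theta * N by rewrite ler_pM2r //; lra.
  have -> : N / b = b^-1 * N by rewrite mulrC.
  rewrite ltr_norml; apply/andP; split; lra.
- move=> i v vi; split; first exact: inner.
  rewrite -Gn; apply: (@degree_ge R G p (V i) v t eta) => //.
  + by rewrite tE.
  + exact: inner.
  (* The vertex [v] is rewired to the complement of [V i]. As [v] lies in [V i], the condition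
     [w != v] costs nothing, and [V i] supplies the common neighbours that keep the graph
     family-free. *)
  + rewrite pe (eq_bigl (fun w => (w \in ~: V i) && (w != v))); last first.
      by move=> w; case: (eqVneq w v) => [->|]; rewrite ?andbT ?andbF // inE vi.
    apply: rew => //; apply: (@rewire_family_free I Fam G t k2 (V i)) => //.
      by move=> u; rewrite !inE => ui; apply: (Vm (g u)); rewrite ?inE // eq_sym.
    rewrite -(ler_nat R) natrD natrM tE; apply: le_trans (Vsz i); lra.
Qed.
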